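(* Let $\mathscr{S}$ be an oriented surface of class $C^3$ in three-dimensional Euclidean space, with unit normal $\bm{\nu}$, and let $\bm{y}:\mathscr{S}\to\mathscr{S}^\ast=\bm{y}(\mathscr{S})$ be an isometric deformation with polar rotation $\mathbf{R}$. Let $(\bm{e}_1,\bm{e}_2,\bm{\nu})$ be any positively oriented orthonormal moving frame on $\mathscr{S}$ and write the invariant rotation gradient $\mathbf{H}=\mathbf{R}^{\mathsf T}\nabla_{\mathrm s}\mathbf{R}$ as $$\mathbf{H}=\mathbf{W}(\bm{e}_1)\otimes\bm{a}_1+\mathbf{W}(\bm{e}_2)\otimes\bm{a}_2+\mathbf{W}(\bm{\nu})\otimes\bm{a}_3$$ with tangential vector fields $\bm{a}_1,\bm{a}_2,\bm{a}_3$. Then $$\bm{a}_3=\bm{0}\quad\text{and}\quad K^\ast=K,$$ where $K(\bm{x})$ is the Gaussian curvature of $\mathscr{S}$ at $\bm{x}$ and $K^\ast$ is the Gaussian curvature of $\mathscr{S}^\ast$ at $\bm{y}(\bm{x})$, for every $\bm{x}\in\mathscr{S}$.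
   Context: Surface gradient: for a differentiable scalar, vector or tensor field $f$ on $\mathscr{S}$, $\nabla_{\mathrm s}f$ is the tensor of one rank higher that annihilates $\bm{\nu}$ (in its last slot) and satisfies $\frac{d}{dt}f(\bm{x}(t))=(\nabla_{\mathrm s}f)\dot{\bm{x}}$ along every smooth curve $\bm{x}(t)$ on $\mathscr{S}$. The curvature tensor is $\nabla_{\mathrm s}\bm{\nu}$ (symmetric); its eigenvalues on the tangent plane are the principal curvatures, and the Gaussian curvature $K$ is their product. $\mathbf{P}(\bm{\nu})=\mathbf{I}-\bm{\nu}\otimes\bm{\nu}$ is the projection onto the tangent plane. Deformation: a twice continuously differentiable one-to-one map $\bm{y}$ of $\mathscr{S}$ onto a surface $\mathscr{S}^\ast$ with $\nabla_{\mathrm s}\bm{y}$ of rank two on every tangent plane. The polar decomposition is $\nabla_{\mathrm s}\bm{y}=\mathbf{R}\mathbf{U}$, where $\mathbf{U}(\bm{x})$ is symmetric and positive definite on the tangent plane at $\bm{x}$ (with $\mathbf{U}\bm{\nu}=\bm{0}$) and $\mathbf{R}(\bm{x})\in\mathsf{SO}(3)$ is the polar rotation; $\mathscr{S}^\ast$ is oriented by the unit normal $\bm{\nu}^\ast(\bm{y}(\bm{x}))=\mathbf{R}(\bm{x})\bm{\nu}(\bm{x})$. A deformation is isometric (an isometry) if it preserves both angles and areas; equivalently $\mathbf{U}=\mathbf{P}(\bm{\nu})$, i.e. $\nabla_{\mathrm s}\bm{y}=\mathbf{R}\mathbf{P}(\bm{\nu})$ with $\mathbf{R}(\bm{x})\in\mathsf{SO}(3)$.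 Invariant rotation gradient: the third-rank tensor with components $H_{ijk}=R_{hi}R_{hj;k}$ (sum over $h$), where $;k$ denotes surface differentiation. $\mathbf{W}(\bm{u})$ is the skew-symmetric tensor with $\mathbf{W}(\bm{u})\bm{v}=\bm{u}\times\bm{v}$. Since $H_{ijk}$ is skew in $(i,j)$, the displayed representation of $\mathbf{H}$ exists and is unique for each moving frame; the vectors $\bm{a}_i$ are tangent to $\mathscr{S}$. *)

(* Defs.v *)
From HB Require Import structures.
From mathcomp Require Import all_boot all_order all_algebra.
From mathcomp Require Import all_classical all_reals all_analysis.

Set Implicit Arguments.
Unset Strict Implicit.
Unset Printing Implicit Defensive.

Import Order.TTheory GRing.Theory Num.Theory.
Import numFieldNormedType.Exports.

Local Open Scope classical_set_scope.
Local Open Scope ring_scope.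

(** ** Euclidean vector algebra

    The norm [`| _ |] that the library puts on matrices is the maximum norm;
    it is used only through the topology and the differential calculus it
    induces.  Lengths and angles are Euclidean. *)

Definition dotv {R : realType} (u v : 'cV[R]_3) : R := (u^T *m v) 0 0.

Definition enorm {R : realType} (u : 'cV[R]_3) : R := Num.sqrt (dotv u u).

(* [i + 1] and [i + 2] are taken modulo 3 in 'I_3. *)
Definition crossv {R : realType} (u v : 'cV[R]_3) : 'cV[R]_3 :=
  \col_i (u (i + 1) 0 * v (i + 2) 0 - u (i + 2) 0 * v (i + 1) 0).

Definition angle {R : realType} (u v : 'cV[R]_3) : R :=
  acos (dotv u v / (enorm u * enorm v)).

Definition SO3 {R : realType} (Q : 'M[R]_3) : Prop :=
  Q^T *m Q = 1%:M /\ \det Q = 1.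

(* W(u): the matrix whose j-th column is u x e_j. *)
Definition skewW {R : realType} (u : 'cV[R]_3) : 'M[R]_3 :=
  \matrix_(i, j) crossv u (delta_mx j 0) i 0.

(** A third-rank tensor [T] is represented by the linear map
    [v |-> T v : 'M_3] contracting its last slot, so that
    [T_ijk = T (delta_mx k 0) i j]. *)

Definition tensor3 (R : realType) := 'cV[R]_3 -> 'M[R]_3.

Definition otimes {R : realType} (A : 'M[R]_3) (a : 'cV[R]_3) : tensor3 R :=
  fun v => dotv a v *: A.

(** ** Regularity classes *)

Fixpoint classC {R : realType} {V W : normedModType R} (k : nat)
    (A : set V) (f : V -> W) : Prop :=
  match k with
  | 0 => forall a, A a -> {for a, continuous f}
  | k'.+1 => (forall a, A a -> differentiable f a) /\
             (forall v : V, classC k' A ('D_v f))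
  end.

(** ** Surfaces *)

(* The last clause, together with continuity and injectivity of [X], says that
   [X] is a homeomorphism of [U] onto a relatively open subset of [S]. *)
Definition chart {R : realType} (k : nat) (S : set 'cV[R]_3)
    (U : set 'cV[R]_2) (X : 'cV[R]_2 -> 'cV[R]_3) : Prop :=
  [/\ open U,
      classC k U X,
      set_inj U X,
      (forall u, U u -> forall v, 'd X u v = 0 -> v = 0) &
      (forall V, open V -> V `<=` U ->
         exists2 O : set 'cV[R]_3, open O & X @` V = S `&` O)].

Definition surface {R : realType} (k : nat) (S : set 'cV[R]_3) : Prop :=
  forall x, S x -> exists U X, chart k S U X /\ (X @` U) x.

Definition classC_on {R : realType} {W : normedModType R} (k : nat)
    (S : set 'cV[R]_3) (f : 'cV[R]_3 -> W) : Prop :=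
  forall U X, chart k S U X -> classC k U (f \o X).

(* On a surface of finite class, curves cannot be smoother than the surface
   itself: smooth curves are the continuously differentiable ones. *)
Definition curve_through {R : realType} (S : set 'cV[R]_3) (x : 'cV[R]_3)
    (c : R^o -> 'cV[R]_3) : Prop :=
  c 0 = x /\
  exists2 e : R, 0 < e &
    classC 1 `]-e, e[ c /\ (forall t : R, t \in `]-e, e[ -> S (c t)).

Definition velocity {R : realType} (c : R^o -> 'cV[R]_3) : 'cV[R]_3 :=
  'D_1 c 0.

Definition tangent {R : realType} (S : set 'cV[R]_3) (x : 'cV[R]_3) :
    set 'cV[R]_3 :=
  [set velocity c | c in curve_through S x].

Definition unit_normal {R : realType} (S : set 'cV[R]_3)
    (nu : 'cV[R]_3 -> 'cV[R]_3) : Prop :=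
  {within S, continuous nu} /\
  forall x, S x ->
    enorm (nu x) = 1 /\ (forall v, tangent S x v -> dotv (nu x) v = 0).

(** ** Surface gradient *)

Definition is_sgrad {R : realType} {W : normedModType R} (S : set 'cV[R]_3)
    (nu : 'cV[R]_3 -> 'cV[R]_3) (f : 'cV[R]_3 -> W) (x : 'cV[R]_3)
    (G : 'cV[R]_3 -> W) : Prop :=
  [/\ linear G,
      G (nu x) = 0 &
      forall c, curve_through S x c ->
        is_derive (0 : R^o) (1 : R^o) (f \o c) (G (velocity c))].

(* The gradient is zero by convention where it does not exist.  Curves are only
   looked at for parameters near 0, so only the values of [f] on [S] matter. *)
Definition sgrad {R : realType} {W : normedModType R} (S : set 'cV[R]_3)
    (nu : 'cV[R]_3 -> 'cV[R]_3) (f : 'cV[R]_3 -> W) (x : 'cV[R]_3) :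
    'cV[R]_3 -> W :=
  xget (fun=> 0) [set G | is_sgrad S nu f x G].

(* The gradient of a vector field as a second-rank tensor. *)
Definition sgrad_mx {R : realType} (S : set 'cV[R]_3)
    (nu f : 'cV[R]_3 -> 'cV[R]_3) (x : 'cV[R]_3) : 'M[R]_3 :=
  \matrix_(i, j) sgrad S nu f x (delta_mx j 0) i 0.

(** ** Curvature *)

Definition curvature_tensor {R : realType} (S : set 'cV[R]_3)
    (nu : 'cV[R]_3 -> 'cV[R]_3) (x : 'cV[R]_3) : 'M[R]_3 :=
  sgrad_mx S nu nu x.

(* [k1] and [k2] are the eigenvalues, counted with multiplicity, of the
   (diagonalizable) curvature tensor on the tangent plane. *)
Definition principal_curvatures {R : realType} (S : set 'cV[R]_3)
    (nu : 'cV[R]_3 -> 'cV[R]_3) (x : 'cV[R]_3) (k1 k2 : R) : Prop :=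
  exists u1 u2 : 'cV[R]_3,
    [/\ tangent S x u1, tangent S x u2, free [:: u1; u2],
        curvature_tensor S nu x *m u1 = k1 *: u1 &
        curvature_tensor S nu x *m u2 = k2 *: u2].

Definition gaussian_curvature {R : realType} (S : set 'cV[R]_3)
    (nu : 'cV[R]_3 -> 'cV[R]_3) (x : 'cV[R]_3) : R :=
  xget 0 [set K | exists k1 k2,
                    principal_curvatures S nu x k1 k2 /\ K = k1 * k2].

(** ** Deformations *)

(* [sgrad_mx] annihilates the normal, so its rank is the rank of its
   restriction to the tangent plane. *)
Definition deformation {R : realType} (S : set 'cV[R]_3)
    (nu y : 'cV[R]_3 -> 'cV[R]_3) : Prop :=
  [/\ classC_on 2 S y,
      set_inj S y,
      surface 2 (y @` S) &
      forall x, S x -> \rank (sgrad_mx S nu y x) = 2%N].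

Definition polar_decomposition {R : realType} (S : set 'cV[R]_3)
    (nu y : 'cV[R]_3 -> 'cV[R]_3) (Q U : 'cV[R]_3 -> 'M[R]_3) : Prop :=
  forall x, S x ->
    [/\ sgrad_mx S nu y x = Q x *m U x,
        SO3 (Q x),
        (U x)^T = U x,
        U x *m nu x = 0 &
        forall v, tangent S x v -> v != 0 -> 0 < dotv v (U x *m v)].

Definition preserves_angles {R : realType} (S : set 'cV[R]_3)
    (nu y : 'cV[R]_3 -> 'cV[R]_3) : Prop :=
  forall x u v, S x -> tangent S x u -> tangent S x v -> u != 0 -> v != 0 ->
    angle (sgrad_mx S nu y x *m u) (sgrad_mx S nu y x *m v) = angle u v.

(* Preservation of the area element: [enorm (crossv u v)] is the area of the
   parallelogram spanned by the tangent vectors [u] and [v]. *)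
Definition preserves_areas {R : realType} (S : set 'cV[R]_3)
    (nu y : 'cV[R]_3 -> 'cV[R]_3) : Prop :=
  forall x u v, S x -> tangent S x u -> tangent S x v ->
    enorm (crossv (sgrad_mx S nu y x *m u) (sgrad_mx S nu y x *m v)) =
    enorm (crossv u v).

Definition isometric_deformation {R : realType} (S : set 'cV[R]_3)
    (nu y : 'cV[R]_3 -> 'cV[R]_3) : Prop :=
  [/\ deformation S nu y, preserves_angles S nu y & preserves_areas S nu y].

(* H_ijk = Q_hi Q_hj;k, summed over h. *)
Definition invariant_rotation_gradient {R : realType} (S : set 'cV[R]_3)
    (nu : 'cV[R]_3 -> 'cV[R]_3) (Q : 'cV[R]_3 -> 'M[R]_3) (x : 'cV[R]_3) :
    tensor3 R :=
  fun v => (Q x)^T *m sgrad S nu Q x v.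

(* No regularity of [e1] and [e2] is required. *)
Definition moving_frame {R : realType} (S : set 'cV[R]_3)
    (nu e1 e2 : 'cV[R]_3 -> 'cV[R]_3) : Prop :=
  forall x, S x ->
    [/\ enorm (e1 x) = 1, enorm (e2 x) = 1, dotv (e1 x) (e2 x) = 0,
        dotv (e1 x) (nu x) = 0 /\ dotv (e2 x) (nu x) = 0 &
        0 < dotv (crossv (e1 x) (e2 x)) (nu x)].

Definition tangential {R : realType} (S : set 'cV[R]_3)
    (a : 'cV[R]_3 -> 'cV[R]_3) : Prop :=
  forall x, S x -> tangent S x (a x).

(* Main.v *)
Require Import Defs.
From HB Require Import structures.
From mathcomp Require Import all_boot all_order all_algebra.
From mathcomp Require Import all_classical all_reals all_analysis.
From mathcomp Require Import ring lra.

Import Order.TTheory GRing.Theory Num.Theory.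
Import numFieldNormedType.Exports.

Local Open Scope classical_set_scope.
Local Open Scope ring_scope.

(** The isometric image [Y = y o X] of a chart [X] satisfies [dY = Q dX], hence
    has the same metric as [X], and by the open mapping argument it is again a
    parametrization.  Symmetry of mixed derivatives of [X] and [Y] gives
    [H(v) w = H(w) v] for tangent [v] and [w]; with [v, w] the frame vectors the
    components along the frame are those of [a3], which therefore vanishes.

    [Y] is only of class C^2, so the second derivatives of its metric do not
    give the Gauss equation directly.  Instead, let [p] be the value of [Y_2] at
    the base point.  The derivatives of [p . Y_1] are
    [p . Y_1i = Y_2 . Y_1i - (Y_2 - p) . Y_1i].  The first term is a Christoffel
    symbol, so it equals [X_2 . X_1i] and is differentiable, because [X] is of
    class C^3.  The second one is differentiable at the base point because
    [Y_2 - p] vanishes there.  Schwarz's theorem for [p . Y_1] then expresses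
    [Y_22 . Y_11 - Y_12 . Y_12] through the Christoffel symbols, so it is the same
    for [X] and [Y].  Subtracting the equal tangential parts leaves the equality
    of the determinants of the second fundamental forms. *)

Set Implicit Arguments.
Unset Strict Implicit.
Unset Printing Implicit Defensive.

(** * Arithmetic and case analysis on three indices *)

Lemma ord3E : ((1 + 1 = 2 :> 'I_3)%R * (1 + 2 = 0 :> 'I_3)%R *
  (2 + 1 = 0 :> 'I_3)%R * (2 + 2 = 1 :> 'I_3)%R)%type.
Proof. by do !split; apply: val_inj. Qed.

Lemma sum3 (V : nmodType) (F : 'I_3 -> V) : \sum_i F i = F 0 + F 1 + F 2.
Proof.
rewrite !big_ord_recl big_ord0 addr0 addrA.
by congr (_ + F _ + F _); apply: val_inj.
Qed.

Lemma forall_ord3 (P : 'I_3 -> Prop) : P 0 -> P 1 -> P 2 -> forall i, P i.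
Proof.
move=> P0 P1 P2 [[|[|[|//]]] lti].
- by rewrite (_ : Ordinal lti = 0) //; apply: val_inj.
- by rewrite (_ : Ordinal lti = 1) //; apply: val_inj.
- by rewrite (_ : Ordinal lti = 2) //; apply: val_inj.
Qed.

(** * Scalar and cross products in coordinates *)

Section EuclideanAlgebra.
Context {R : realType}.
Implicit Types (u v w : 'cV[R]_3) (A : 'M[R]_3) (k : R).

Lemma eq_cV3 u v : u 0 0 = v 0 0 -> u 1 0 = v 1 0 -> u 2 0 = v 2 0 -> u = v.
Proof.
move=> h0 h1 h2; apply/matrixP => i j; rewrite (ord1 j).
by move: i; apply: forall_ord3.
Qed.

Lemma dotvE u v : dotv u v = u 0 0 * v 0 0 + u 1 0 * v 1 0 + u 2 0 * v 2 0.
Proof. by rewrite /dotv mxE sum3 !mxE. Qed.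

Lemma crossvE u v : ((crossv u v 0 0 = u 1 0 * v 2 0 - u 2 0 * v 1 0)%R *
  (crossv u v 1 0 = u 2 0 * v 0 0 - u 0 0 * v 2 0)%R *
  (crossv u v 2 0 = u 0 0 * v 1 0 - u 1 0 * v 0 0)%R)%type.
Proof. by rewrite /crossv; do !split; rewrite mxE ?ord3E ?add0r. Qed.

Lemma dotvC u v : dotv u v = dotv v u.
Proof. by rewrite !dotvE; ring. Qed.

Lemma dotvDl u v w : dotv (u + v) w = dotv u w + dotv v w.
Proof. by rewrite !dotvE !mxE; ring. Qed.

Lemma dotvDr u v w : dotv u (v + w) = dotv u v + dotv u w.
Proof. by rewrite !dotvE !mxE; ring. Qed.

Lemma dotvZl k u v : dotv (k *: u) v = k * dotv u v.
Proof. by rewrite !dotvE !mxE; ring. Qed.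

Lemma dotvZr k u v : dotv u (k *: v) = k * dotv u v.
Proof. by rewrite !dotvE !mxE; ring. Qed.

Lemma dotvNl u v : dotv (- u) v = - dotv u v.
Proof. by rewrite !dotvE !mxE; ring. Qed.

Lemma dotvNr u v : dotv u (- v) = - dotv u v.
Proof. by rewrite !dotvE !mxE; ring. Qed.

Lemma dotvBl u v w : dotv (u - v) w = dotv u w - dotv v w.
Proof. by rewrite dotvDl dotvNl. Qed.

Lemma dotvBr u v w : dotv u (v - w) = dotv u v - dotv u w.
Proof. by rewrite dotvDr dotvNr. Qed.

Lemma dotv0l u : dotv 0 u = 0.
Proof. by rewrite !dotvE !mxE; ring. Qed.

Lemma dotv0r u : dotv u 0 = 0.
Proof. by rewrite dotvC dotv0l. Qed.

Lemma dotvv_ge0 u : 0 <= dotv u u.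
Proof. by rewrite dotvE !addr_ge0 // -expr2 sqr_ge0. Qed.

Lemma dotvv_eq0 u : dotv u u = 0 -> u = 0.
Proof.
rewrite dotvE -!expr2 => /eqP.
rewrite !paddr_eq0 ?addr_ge0 ?sqr_ge0 // !sqrf_eq0 => /andP[/andP[/eqP h0 /eqP h1] /eqP h2].
by apply: eq_cV3; rewrite mxE.
Qed.

Lemma dotvv_gt0 u : u != 0 -> 0 < dotv u u.
Proof.
by move=> u0; rewrite lt_neqAle dotvv_ge0 andbT eq_sym; apply: contra_neq u0 => /dotvv_eq0.
Qed.

Lemma dotv_trmx A u v : dotv (A *m u) v = dotv u (A^T *m v).
Proof. by rewrite /dotv trmx_mul mulmxA. Qed.

Lemma mul_skewW u v : skewW u *m v = crossv u v.
Proof.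
by apply: eq_cV3; rewrite mxE sum3 !mxE ?ord3E ?add0r /=; ring.
Qed.

Lemma enorm_sqr u : enorm u ^+ 2 = dotv u u.
Proof. by rewrite /enorm sqr_sqrtr // dotvv_ge0. Qed.

Lemma enorm1 u : enorm u = 1 <-> dotv u u = 1.
Proof.
split=> [u1|u1]; first by rewrite -enorm_sqr u1 expr1n.
by rewrite /enorm u1 sqrtr1.
Qed.

Lemma dotv_crossl u v : dotv u (crossv u v) = 0.
Proof. by rewrite dotvE !crossvE; ring. Qed.

Lemma dotv_crossr u v : dotv v (crossv u v) = 0.
Proof. by rewrite dotvE !crossvE; ring. Qed.

Lemma lagrange u v : dotv (crossv u v) (crossv u v) = dotv u u * dotv v v - dotv u v ^+ 2.
Proof. by rewrite !dotvE !crossvE; ring. Qed.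

(* Expansion in the basis (u, v, u x v), multiplied by the Gram determinant. *)
Lemma cross_expand u v w :
  dotv (crossv u v) (crossv u v) *: w =
  (dotv w u * dotv v v - dotv w v * dotv u v) *: u +
  (dotv w v * dotv u u - dotv w u * dotv u v) *: v +
  dotv w (crossv u v) *: crossv u v.
Proof. by apply: eq_cV3; rewrite !mxE !dotvE !crossvE ?mxE ?ord3E ?add0r; ring. Qed.

End EuclideanAlgebra.

(** * Differential calculus of matrix-valued maps *)

Section DifferentialCalculus.
Context {R : realType}.

Lemma differentiable_mx (V : normedModType R) m n (f : V -> 'M[R]_(m, n)) a :
  (forall i j, differentiable (fun x => f x i j) a) -> differentiable f a.
Proof.
move=> df; rewrite (_ : f = \sum_(i < m) \sum_(j < n)
    (fun x => f x i j *: (delta_mx i j : 'M[R]_(m, n)))); last first.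
  apply/funext => x; rewrite fct_sumE [LHS]matrix_sum_delta.
  by apply: eq_bigr => i _; rewrite fct_sumE.
apply: differentiable_sum => i; apply: differentiable_sum => j.
exact: differentiableZl.
Qed.

Lemma differentiable_entry (V : normedModType R) m n (f : V -> 'M[R]_(m, n)) a i j :
  differentiable f a -> differentiable (fun x => f x i j) a.
Proof.
move=> df; apply: (@differentiable_comp _ _ _ _ f (fun N => N i j)) => //.
exact: differentiable_coord.
Qed.

Lemma differentiable_dotv (V : normedModType R) (f g : V -> 'cV[R]_3) a :
  differentiable f a -> differentiable g a ->
  differentiable (fun x => dotv (f x) (g x)) a.
Proof.
move=> df dg; under eq_fun do rewrite dotvE.
by apply: differentiableD; [apply: differentiableD|];
  apply: differentiableM; apply: differentiable_entry.
Qed.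

Lemma differentiable_crossv (V : normedModType R) (f g : V -> 'cV[R]_3) a :
  differentiable f a -> differentiable g a ->
  differentiable (fun x => crossv (f x) (g x)) a.
Proof.
move=> df dg; apply: differentiable_mx => i j; under eq_fun do rewrite mxE.
by apply: differentiableB; apply: differentiableM; apply: differentiable_entry.
Qed.

Lemma derivable_entry (V : normedModType R) m n (f : V -> 'M[R]_(m, n)) a v i j :
  derivable f a v -> is_derive a v (fun x => f x i j) ('D_v f a i j).
Proof.
move=> df; split; first exact: (derivable_mxP _ _ _).1.
by rewrite derive_mx // mxE.
Qed.

Lemma is_derive_dotv (V : normedModType R) (f g : V -> 'cV[R]_3) a v :
  derivable f a v -> derivable g a v ->
  is_derive a v (fun x => dotv (f x) (g x))
    (dotv ('D_v f a) (g a) + dotv (f a) ('D_v g a)).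
Proof.
move=> df dg; under eq_fun do rewrite dotvE.
have dfi i := derivable_entry i 0 df; have dgi i := derivable_entry i 0 dg.
by apply: is_derive_eq; rewrite !dotvE /GRing.scale /=; ring.
Qed.

Lemma is_derive_mulmx (V : normedModType R) (M : V -> 'M[R]_3) (f : V -> 'cV[R]_3) a v :
  derivable M a v -> derivable f a v ->
  is_derive a v (fun x => M x *m f x) ('D_v M a *m f a + M a *m 'D_v f a).
Proof.
move=> dM df; have dMi i j := derivable_entry i j dM; have dfi i := derivable_entry i 0 df.
have dMf i j : is_derive a v (fun x => (M x *m f x) i j)
    (('D_v M a *m f a + M a *m 'D_v f a) i j).
  rewrite (ord1 j); under eq_fun do rewrite mxE sum3.
  by apply: is_derive_eq; rewrite !mxE !sum3 /GRing.scale /=; ring.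
split; first by apply/derivable_mxP => i j; have [] := dMf i j.
rewrite derive_mx; last by apply/derivable_mxP => i j; have [] := dMf i j.
by apply/matrixP => i j; rewrite mxE; have [_] := dMf i j.
Qed.

(** The little-o condition in epsilon form. One estimate gives both differentiability and the value
    of the differential, whenever an explicit candidate [L] is at hand. *)
Lemma differentiable_le (V W : normedModType R) (f : V -> W) (L : {linear V -> W}) a :
  continuous L ->
  (forall e, 0 < e -> \forall x \near a, `|f x - f a - L (x - a)| <= e * `|x - a|) ->
  differentiable f a /\ 'd f a = L :> (V -> W).
Proof.
move=> cL fL.
have fLo : f \o shift a = cst (f a) + L +o_ 0 id.
  apply/eqaddoP => e e0; have := fL _ e0.
  rewrite (near_shift 0 a) subr0; apply: filterS => h /=.
  by rewrite addrK -addrA -opprD.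
have dfL := diff_unique cL fLo; split => //.
by apply/diff_locallyP; rewrite dfL.
Qed.

Lemma differentiable_leP (V W : normedModType R) (f : V -> W) a :
  differentiable f a ->
  forall e, 0 < e -> \forall x \near a, `|f x - f a - 'd f a (x - a)| <= e * `|x - a|.
Proof.
move=> /diff_locallyP[_ /eqaddoP fLo] e e0; have := fLo _ e0.
rewrite /= [in X in _ -> X](near_shift 0 a) subr0; apply: filterS => h /=.
by rewrite addrK -addrA -opprD.
Qed.

Lemma near_eq_differentiable (V W : normedModType R) (f g : V -> W) a :
  (\near a, f a = g a) -> differentiable f a ->
  differentiable g a /\ 'd g a = 'd f a :> (V -> W).
Proof.
move=> fg df; apply: differentiable_le; first exact: diff_continuous.
move=> e e0; have fa := nbhs_singleton fg.
by apply: filterS2 fg (differentiable_leP df e0) => x <-; rewrite fa.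
Qed.

Lemma linear_cVP m n (f : {linear 'cV[R]_n -> 'cV[R]_m}) :
  exists A : 'M[R]_(m, n), forall v, f v = A *m v.
Proof.
exists (\matrix_(i, j) f (delta_mx j 0) i 0) => v.
rewrite {1}[v]matrix_sum_delta linear_sum; apply/matrixP => i j.
rewrite (ord1 j) !mxE summxE; apply: eq_bigr => k _.
by rewrite big_ord1 linearZ !mxE mulrC.
Qed.

Lemma injective_unitmx n (A : 'M[R]_n) :
  (forall v : 'cV[R]_n, A *m v = 0 -> v = 0) -> A \in unitmx.
Proof.
move=> injA; rewrite -unitmx_tr -row_free_unit -kermx_eq0; apply/eqP/matrixP => i j.
have Ki : (row i (kermx A^T))^T = 0.
  by apply: injA; apply: trmx_inj; rewrite trmx_mul trmxK trmx0 -row_mul mulmx_ker row0.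
by have := congr1 (fun w : 'cV[R]_n => w j 0) Ki; rewrite !mxE.
Qed.

Lemma mulmx_continuous m n (A : 'M[R]_(m, n)) : continuous (mulmx A : 'cV[R]_n -> 'cV[R]_m).
Proof.
move=> x; apply: differentiable_continuous; apply: differentiable_mx => i j.
under eq_fun do rewrite mxE.
rewrite (_ : (fun _ => _) = \sum_(k < n) (fun x : 'cV[R]_n => A i k * x k j)); last first.
  by apply/funext => y; rewrite fct_sumE.
apply: differentiable_sum => k; apply: differentiableM => //.
exact: differentiable_coord.
Qed.

End DifferentialCalculus.

(** * Local parametrizations and lifting of maps into the surface *)

Section Parametrization.
Context {R : realType}.
Implicit Types (S : set 'cV[R]_3) (U : set 'cV[R]_2) (X : 'cV[R]_2 -> 'cV[R]_3).

Lemma classC_continuous (V W : normedModType R) k (A : set V) (f : V -> W) :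
  classC k A f -> forall a, A a -> {for a, continuous f}.
Proof.
case: k => [|k] //= [df _] a Aa; exact/differentiable_continuous/df.
Qed.

Lemma classC_le (V W : normedModType R) k k' (A : set V) (f : V -> W) :
  (k <= k')%N -> classC k' A f -> classC k A f.
Proof.
elim: k k' f => [|k IH] [|k'] f //=; first by move=> _ /(@classC_continuous _ _ k'.+1).
by move=> kk' [df Df]; split => // v; exact: (IH k').
Qed.

(* The last clause says that the inverse of [X] is continuous on [S]. *)
Definition parametrization S U X : Prop :=
  [/\ open U, set_inj U X, classC 1 U X,
      (forall u, U u -> forall v, 'd X u v = 0 -> v = 0) &
      (forall u, U u -> S (X u) /\ forall V, nbhs u V ->
         \forall p \near X u, S p -> (X @` (V `&` U)) p)].

(** A neighbourhood [V] of [u] is shrunk to its interior within [U]; the image of that open set is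
    relatively open, hence contains every point of [S] near [X u]. *)
Lemma chart_parametrization k S U X : chart k.+1 S U X -> parametrization S U X.
Proof.
move=> [oU CX injX immX homX]; split => //; first exact: classC_le CX.
move=> u Uu; split.
  have [G oG XG] := homX U oU (@subset_refl _ U).
  by have [] : (S `&` G) (X u) by rewrite -XG; exists u.
move=> V uV; have [G oG XG] := homX _ (openI (@open_interior _ V) oU) (@subIsetr _ _ _).
have [_ GXu] : (S `&` G) (X u) by rewrite -XG; exists u.
apply: filterS (open_nbhs_nbhs (conj oG GXu)) => p Gp Sp.
have [v [Vv Uv] <-] : (X @` (V^° `&` U)) p by rewrite XG.
by exists v => //; split => //; exact: interior_subset.
Qed.

(** With [J] the matrix of the differential, [L] is the pseudo-inverse [(J^T J)^-1 J^T]: injectivity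
    of [J] makes [J^T J] invertible, and [J^T] kills every vector orthogonal to the image of [J]. *)
Lemma parametrization_left_inverse S U X u : parametrization S U X -> U u ->
  exists L : 'M[R]_(2, 3), (forall v, L *m 'd X u v = v) /\
    (forall n, (forall v, dotv n ('d X u v) = 0) -> L *m n = 0).
Proof.
move=> [_ _ _ immX _] Uu; have [J JE] := linear_cVP ('d X u).
have JJu : J^T *m J \in unitmx.
  apply: injective_unitmx => v JJv; apply: (immX u Uu); rewrite JE; apply: dotvv_eq0.
  by rewrite /dotv trmx_mul -mulmxA (mulmxA J^T) JJv mulmx0 mxE.
exists (invmx (J^T *m J) *m J^T); split => [v|n nJ].
  by rewrite JE -mulmxA (mulmxA J^T) mulKmx.
rewrite -mulmxA (_ : J^T *m n = 0) ?mulmx0 //.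
apply: trmx_inj; rewrite trmx_mul trmxK trmx0; apply/matrixP => i j.
rewrite (ord1 i) [RHS]mxE -(nJ (delta_mx j 0)) JE /dotv.
by rewrite mulmxA -colE [RHS]mxE.
Qed.

(** The lift is the inverse of [X] applied to [c], continuous by the last clause of
    [parametrization]. Applying [L] to the expansion of [X] at [u0] first shows that its increment
    is of the order of [t - t0], and then that its differential is [L] after ['d c t0]. The source
    [W] is the line for curves and the plane for transition maps. *)
Lemma parametrization_lift (W : normedModType R) S U X (c : W -> 'cV[R]_3) t0 u0 :
  parametrization S U X -> U u0 -> c t0 = X u0 -> differentiable c t0 ->
  (\forall t \near t0, S (c t)) ->
  exists psi : W -> 'cV[R]_2, [/\ psi t0 = u0, differentiable psi t0 &
    \forall t \near t0, U (psi t) /\ X (psi t) = c t].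
Proof.
move=> pX Uu0 ct0 dc Sc.
have [L [LX _]] := parametrization_left_inverse pX Uu0.
have [oU injX [dX _] immX homX] := pX.
(* Injectivity of [X] makes the chosen preimage unique; [u0] is the default where [c t] lies outside
   the image of [U]. *)
pose psi t := xget u0 [set u | U u /\ X u = c t].
have psi_eq t u : U u -> X u = c t -> psi t = u.
  move=> Uu Xu; rewrite /psi; case: xgetP => [v _ [Uv Xv]|/(_ u)]; last by case.
  by apply: injX; rewrite ?inE // Xv.
have cV V : nbhs u0 V -> \forall t \near t0, (X @` (V `&` U)) (c t).
  move=> /(homX u0 Uu0).2; rewrite -ct0 => /(differentiable_continuous dc) cX.
  by apply: filterS2 Sc cX => t Sct; exact.
have psiV V : nbhs u0 V -> \forall t \near t0, [/\ V (psi t), U (psi t) & X (psi t) = c t].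
  by move=> /cV; apply: filterS => t [u [Vu Uu] Xu]; rewrite (psi_eq t u).
have psi0 : psi t0 = u0 by exact: psi_eq.
exists psi; split => //; last first.
  by apply: filterS (psiV _ (open_nbhs_nbhs (conj oU Uu0))) => t [].
have LC : continuous (mulmx L : 'cV[R]_3 -> 'cV[R]_2) by exact: mulmx_continuous.
have [C C0 LCle] := linear_lipschitz LC.
have [K K0 cKle] := linear_lipschitz (diff_continuous dc).
have dcC := diff_continuous dc.
pose Lc : {linear W -> 'cV[R]_2} := (mulmx L \o 'd c t0).
suff [] : differentiable psi t0 /\ 'd psi t0 = Lc :> (W -> _) by [].
apply: differentiable_le; rewrite /Lc.
  by move=> x; apply: continuous_comp; [exact: dcC|exact: LC].
move=> e e0.
(* [M] will bound the increment of [psi] by that of [t]. The bound [C * eta <= 1 / 2] lets the error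
   term in [h] be absorbed on the left, and [C * eta * M <= e / 2] makes it small compared with
   [t - t0]; [eta2] plays the same role for the error of [c]. *)
pose M := 2 * C * (K + 1).
have M0 : 0 < M by rewrite !mulr_gt0 // addr_gt0.
pose eta := Num.min (2 * C)^-1 (e / (2 * C * M)).
have C2 : 0 < 2 * C by rewrite mulr_gt0.
have C2M : 0 < 2 * C * M by rewrite mulr_gt0.
have eta0 : 0 < eta by rewrite lt_min invr_gt0 C2 divr_gt0.
have Ceta : C * eta <= 1 / 2.
  rewrite mulrC -ler_pdivlMr //; apply: (@le_trans _ _ (2 * C)^-1); first by rewrite ge_min lexx.
  by rewrite invfM mul1r.
have CetaM : C * eta * M <= e / 2.
  rewrite -mulrA mulrCA -ler_pdivlMr ?(mulr_gt0 C0 M0) //.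
  apply: (@le_trans _ _ (e / (2 * C * M))); first by rewrite ge_min lexx orbT.
  by rewrite -mulrA invfM mulrA.
pose eta2 := Num.min 1 (e / (2 * C)).
have eta20 : 0 < eta2 by rewrite lt_min ltr01 divr_gt0 // mulr_gt0.
have Ceta2 : C * eta2 <= e / 2.
  rewrite mulrC -ler_pdivlMr //; apply: (@le_trans _ _ (e / (2 * C))); first by rewrite ge_min lexx orbT.
  by rewrite invfM mulrA.
have eta21 : eta2 <= 1 by rewrite ge_min lexx.
have nX := psiV _ (differentiable_leP (dX u0 Uu0) eta0).
have nc := differentiable_leP dc eta20.
apply: filterS2 nX nc => t [hX _ Xpsi] hc.
rewrite psi0 /= in hX *; rewrite Xpsi -ct0 in hX.
set h := psi t - u0 in hX *; set g := c t - c t0 in hX hc; set s := t - t0 in hc *.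
(* Since [L] inverts the differential of [X], the difference [h - L *m g] is minus the image under
   [L] of the remainder of [X] at [u0]. *)
have hg : `|h - L *m g| <= C * eta * `|h|.
  rewrite -[X in X - _](LX h) -mulmxBr -normrN -mulmxN opprB.
  by apply: le_trans (LCle _) _; rewrite -mulrA ler_pM2l.
have gs : `|g| <= (K + 1) * `|s|.
  rewrite -(subrK ('d c t0 s) g); apply: le_trans (ler_normD _ _) _.
  rewrite mulrDl mul1r addrC; apply: lerD; first exact: cKle.
  by apply: le_trans hc _; rewrite ler_piMl.
have hs : `|h| <= M * `|s|.
  have : `|h| <= C * `|g| + 1 / 2 * `|h|.
    rewrite -{1}(subrK (L *m g) h); apply: le_trans (ler_normD _ _) _.
    rewrite addrC; apply: lerD; first exact: LCle.
    by apply: le_trans hg _; rewrite ler_wpM2r.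
  have : C * `|g| <= C * ((K + 1) * `|s|) by rewrite ler_pM2l.
  by rewrite /M; lra.
have -> : h - L *m 'd c t0 s = (h - L *m g) + L *m (g - 'd c t0 s).
  by rewrite [L *m (g - _)]mulmxBr addrA subrK.
apply: le_trans (ler_normD _ _) _.
have h1 : C * eta * `|h| <= e / 2 * `|s|.
  apply: (@le_trans _ _ (C * eta * (M * `|s|))).
    by rewrite ler_pM2l // mulr_gt0.
  by rewrite mulrA ler_wpM2r.
have h2 : `|L *m (g - 'd c t0 s)| <= e / 2 * `|s|.
  apply: le_trans (LCle _) _; apply: (@le_trans _ _ (C * (eta2 * `|s|))).
    by rewrite ler_pM2l.
  by rewrite mulrA ler_wpM2r.
by move: (le_trans hg h1) h2; lra.
Qed.

End Parametrization.

(** * Tangent vectors and surface gradients in a parametrization *)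

Section TangentSpace.
Context {R : realType}.
Implicit Types (S : set 'cV[R]_3) (U : set 'cV[R]_2) (X : 'cV[R]_2 -> 'cV[R]_3).

(** The two difference quotients are the same function. This passes between curves, in which the
    surface gradient is defined, and directional derivatives in the parameter domain. *)
Lemma is_derive_line (V W : normedModType R) (f : V -> W) a v d :
  is_derive (0 : R^o) (1 : R^o) (fun t : R^o => f (t *: v + a)) d <-> is_derive a v f d.
Proof.
have E : (fun h : R => h^-1 *: (((fun t : R^o => f (t *: v + a)) \o shift (0 : R^o)) (h *: (1 : R^o)) -
      f ((0 : R^o) *: v + a))) = (fun h => h^-1 *: ((f \o shift a) (h *: v) - f a)).
  by apply/funext => h /=; rewrite scale0r add0r addr0 [_ *: 1]mulr1.
split=> -[df dfE]; split.
- by move: df; rewrite /derivable E.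
- by move: dfE; rewrite /derive E.
- by rewrite /derivable E.
- by rewrite /derive E.
Qed.

Lemma is_diff_line (V : normedModType R) (a v : V) (t : R^o) :
  is_diff t (fun s : R^o => s *: v + a) (fun s : R^o => s *: v).
Proof.
have h : is_diff t (fun s : R^o => s *: v) (fun s : R^o => s *: v) by exact: is_diff_scalel.
have := is_diffD h (is_diff_cst a t).
by rewrite (_ : (fun s : R^o => s *: v) + 0 = (fun s : R^o => s *: v)) ?addr0.
Qed.

Lemma line_curve S U X u v : parametrization S U X -> U u ->
  curve_through S (X u) (fun t : R^o => X (t *: v + u)) /\
  velocity (fun t : R^o => X (t *: v + u)) = 'd X u v.
Proof.
move=> [oU _ [dX DX] _ homX] Uu; pose l (t : R^o) := t *: v + u.
have dl t := is_diff_line u v t; rewrite -/l in dl.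
have diffl t : differentiable l t by have [] := dl t.
have l0 : l 0 = u by rewrite /l scale0r add0r.
have Ul : \forall t \near (0 : R^o), U (l t).
  by apply: (differentiable_continuous (diffl 0)); rewrite l0; exact: open_nbhs_nbhs.
have DXl t w : U (l t) -> differentiable (X \o l) t /\ 'D_w (X \o l) t = 'D_(w *: v) X (l t).
  move=> Ut; have dXl : differentiable (X \o l) t by apply: differentiable_comp => //; exact: dX.
  split => //; rewrite !deriveE //; last exact: dX.
  by rewrite diff_comp //=; [rewrite (@diff_val _ _ _ _ _ _ _ (dl t))|exact: dX].
split; last first.
  by rewrite /velocity (DXl 0 1 _).2 l0 // scale1r deriveE //; exact: dX.
split; first by rewrite -/(l 0) l0.
have /nbhs_ballP[e /= e0 eU] := Ul.
have {}eU t : `]-e, e[%classic t -> U (l t).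
  rewrite /= in_itv /= => te; apply: eU.
  by rewrite -ball_normE /= sub0r normrN ltr_norml.
exists e => //; split; last by move=> t te; apply: (homX _ _).1; apply: eU.
split => [t te|w t te]; first exact: (DXl t 0 (eU t te)).1.
have nt : \forall s \near (t : R^o), 'D_w (X \o l) s = 'D_(w *: v) X (l s).
  have : nbhs (t : R^o) `]-e, e[%classic by apply: open_nbhs_nbhs; split => //; exact: interval_open.
  by apply: filterS => s /eU Us; rewrite (DXl s w Us).2.
rewrite /prop_for /continuous_at (nbhs_singleton nt).
apply: (@cvg_trans _ ('D_(w *: v) X (l s) @[s --> (t : R^o)])).
  by apply: near_eq_cvg; apply: filterS nt => s ->.
apply: (@continuous_comp _ _ _ l ('D_(w *: v) X) t).
  exact: differentiable_continuous.
exact: DX (eU t te).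
Qed.

Lemma curve_lift S U X u (c : R^o -> 'cV[R]_3) : parametrization S U X -> U u ->
  curve_through S (X u) c ->
  exists psi : R^o -> 'cV[R]_2, [/\ psi 0 = u, differentiable psi 0,
    \forall t \near (0 : R^o), X (psi t) = c t & velocity c = 'd X u ('d psi 0 1)].
Proof.
move=> pX Uu [c0 [e e0 [[dc _] Sc]]]; have [_ _ [dX _] _ _] := pX.
have e0e : `]-e, e[%classic (0 : R) by rewrite /= in_itv /= oppr_lt0 e0.
have dc0 : differentiable c 0 by exact: dc.
have nSc : \forall t \near (0 : R^o), S (c t).
  have : nbhs (0 : R^o) `]-e, e[%classic by apply: open_nbhs_nbhs; split => //; exact: interval_open.
  by apply: filterS => s /Sc.
have [psi [psi0 dpsi Xpsi]] := parametrization_lift pX Uu c0 dc0 nSc.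
have nXpsi : \forall t \near (0 : R^o), (X \o psi) t = c t by apply: filterS Xpsi => t [].
exists psi; split => //.
have dXpsi : differentiable (X \o psi) 0.
  by apply: differentiable_comp => //; rewrite psi0; exact: dX.
rewrite /velocity deriveE // (near_eq_differentiable nXpsi dXpsi).2.
by rewrite diff_comp ?psi0 //; exact: dX.
Qed.

(** A curve on the surface lifts to the parameter domain; conversely the images of straight lines
    realize every value of the differential. *)
Lemma tangentE S U X u : parametrization S U X -> U u ->
  tangent S (X u) = [set 'd X u v | v in setT].
Proof.
move=> pX Uu; apply/seteqP; split => [_ [c cX <-]|_ [v _ <-]].
  by have [psi [_ _ _ ->]] := curve_lift pX Uu cX; exists ('d psi 0 1).
have [cX vX] := line_curve v pX Uu.
by exists (fun t : R^o => X (t *: v + u)).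
Qed.

(** A gradient exists, so [xget] does not return its default: the differential of [f \o X] composed
    with the left inverse [L] kills the normal, and the chain rule along lifted curves gives the
    required derivatives. *)
Lemma is_sgradP (W : normedModType R) S U X u nu (f : 'cV[R]_3 -> W) :
  parametrization S U X -> U u -> (forall v, dotv (nu (X u)) ('d X u v) = 0) ->
  differentiable (f \o X) u -> is_sgrad S nu f (X u) (sgrad S nu f (X u)).
Proof.
move=> pX Uu nuX dfX; apply: (@xgetPex _ (fun=> 0) [set G | is_sgrad S nu f (X u) G]).
have [L [LX Ln]] := parametrization_left_inverse pX Uu.
exists (fun w => 'd (f \o X) u (L *m w)); split.
- by move=> a x y; rewrite mulmxDr -scalemxAr linearP.
- by rewrite Ln // linear0.
move=> c cX; have [psi [psi0 dpsi Xpsi ->]] := curve_lift pX Uu cX.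
rewrite LX.
have dfpsi : differentiable ((f \o X) \o psi) 0.
  by apply: differentiable_comp => //; rewrite psi0.
have nfc : \forall t \near (0 : R^o), ((f \o X) \o psi) t = (f \o c) t.
  by apply: filterS Xpsi => t /= ->.
have [dfc dfcE] := near_eq_differentiable nfc dfpsi.
split; first exact: diff_derivable.
by rewrite deriveE // dfcE diff_comp ?psi0.
Qed.

Lemma is_sgrad_derive (W : normedModType R) S U X u nu (f : 'cV[R]_3 -> W) G :
  parametrization S U X -> U u -> is_sgrad S nu f (X u) G ->
  forall v, is_derive u v (f \o X) (G ('d X u v)).
Proof.
move=> pX Uu [_ _ fG] v; have [cX vX] := line_curve v pX Uu.
by apply/is_derive_line; rewrite -vX; exact: fG.
Qed.

(** Testing on images of straight lines fixes the tangential values of any gradient, hence of the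
    one that [xget] selects. *)
Lemma sgrad_param (W : normedModType R) S U X u nu (f : 'cV[R]_3 -> W) :
  parametrization S U X -> U u -> (forall v, dotv (nu (X u)) ('d X u v) = 0) ->
  differentiable (f \o X) u ->
  forall v, sgrad S nu f (X u) ('d X u v) = 'D_v (f \o X) u.
Proof.
move=> pX Uu nuX dfX v.
by have [_ ->] := is_sgrad_derive pX Uu (is_sgradP pX Uu nuX dfX) v.
Qed.

Lemma sgrad_mxE S nu (f : 'cV[R]_3 -> 'cV[R]_3) x : linear (sgrad S nu f x) ->
  forall v, sgrad_mx S nu f x *m v = sgrad S nu f x v.
Proof.
move=> lf v; pose F : {linear 'cV[R]_3 -> 'cV[R]_3} :=
  HB.pack (sgrad S nu f x) (GRing.isLinear.Build _ _ _ _ _ lf).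
rewrite -[RHS]/(F v) {2}[v]matrix_sum_delta linear_sum; apply/matrixP => i j.
rewrite (ord1 j) !mxE summxE; apply: eq_bigr => k _.
by rewrite big_ord1 linearZ !mxE mulrC.
Qed.

End TangentSpace.

(** * Symmetry of mixed derivatives under differentiability at one point *)

Section Schwarz.
Context {R : realType} {V : normedModType R}.
Implicit Types (f : V -> R) (a v w : V).

Lemma is_derive_along f (v b : V) (s : R^o) : differentiable f (s *: v + b) ->
  is_derive s (1 : R^o) (fun t : R^o => f (t *: v + b)) ('D_v f (s *: v + b)).
Proof.
move=> df; have dl := is_diff_line b v s.
have diffl : differentiable (fun t : R^o => t *: v + b) s by have [] := dl.
have dfl : differentiable (f \o (fun t : R^o => t *: v + b)) s by exact: differentiable_comp.
split; first exact: diff_derivable.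
rewrite (deriveE _ dfl) diff_comp //= (@diff_val _ _ _ _ _ _ _ dl) deriveE //.
by rewrite scale1r.
Qed.

(* Mean value theorem applied to s |-> f (a + s v + t w) - f (a + s v). *)
Lemma second_difference f a v w e : 0 < e ->
  (\forall x \near a, differentiable f x) -> differentiable ('D_v f) a ->
  exists2 d, 0 < d & forall t, 0 < t -> t < d ->
    `|f (t *: v + (t *: w + a)) - f (t *: v + a) - f (t *: w + a) + f a
      - t ^+ 2 * 'D_w ('D_v f) a| <= e * t ^+ 2.
Proof.
(* The points used below lie at distances at most [t * (|v| + |w|)] and [t * |v|] from [a]; [N]
   exceeds the sum of the two factors and is positive even if [v] and [w] vanish. *)
move=> e0 df dDf; pose N := 2 * `|v| + `|w| + 1.
have N0 : 0 < N by rewrite ltr_wpDl // addr_ge0 // mulr_ge0.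
have eta0 : 0 < e / N by rewrite divr_gt0.
have leDf := differentiable_leP dDf eta0.
have /nbhs_ballP[r /= r0 ball_r] : \forall x \near a, differentiable f x /\
    `|'D_v f x - 'D_v f a - 'd ('D_v f) a (x - a)| <= e / N * `|x - a|.
  by apply: filterS2 df leDf => x.
have rP x : `|x - a| < r -> differentiable f x /\
    `|'D_v f x - 'D_v f a - 'd ('D_v f) a (x - a)| <= e / N * `|x - a|.
  by move=> xr; apply: ball_r; rewrite -ball_normE /= distrC.
exists (r / N); first exact: divr_gt0.
move=> t t0; rewrite ltr_pdivlMr // => tr.
have n1 s : 0 <= s <= t -> `|s *: v + (t *: w + a) - a| <= t * (`|v| + `|w|).
  move=> /andP[s0 st]; rewrite addrA addrK mulrDr.
  apply: le_trans (ler_normD _ _) _; rewrite !normrZ (ger0_norm s0) (gtr0_norm t0).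
  by rewrite lerD // ler_wpM2r.
have n2 s : 0 <= s <= t -> `|s *: v + a - a| <= t * `|v|.
  by move=> /andP[s0 st]; rewrite addrK normrZ (ger0_norm s0) ler_wpM2r.
have b1 s : 0 <= s <= t -> `|s *: v + (t *: w + a) - a| < r.
  move=> /n1 /le_lt_trans; apply; apply: le_lt_trans tr; rewrite ler_pM2l //.
  by rewrite /N; have := normr_ge0 v; lra.
have b2 s : 0 <= s <= t -> `|s *: v + a - a| < r.
  move=> /n2 /le_lt_trans; apply; apply: le_lt_trans tr; rewrite ler_pM2l //.
  by rewrite /N; have := normr_ge0 v; have := normr_ge0 w; lra.
pose g (s : R^o) : R := f (s *: v + (t *: w + a)) - f (s *: v + a).
pose dg (s : R^o) : R := 'D_v f (s *: v + (t *: w + a)) - 'D_v f (s *: v + a).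
have gdg s : 0 <= s <= t -> is_derive (s : R^o) (1 : R^o) g (dg s).
  move=> st; apply: is_deriveB; apply: is_derive_along.
    exact: (rP _ (b1 _ st)).1.
  exact: (rP _ (b2 _ st)).1.
have [||c ct gE] := @MVT R g dg 0 t t0.
- by move=> s; rewrite in_itv /= => /andP[s0 st]; apply: gdg; rewrite !ltW.
- apply: derivable_within_continuous => s; rewrite in_itv /= => st.
  by have [] := gdg s st.
move: gE; rewrite /g !scale0r !add0r subr0 => gE.
have {}ct : 0 <= c <= t by move: ct; rewrite in_itv /= => /andP[s0 st]; rewrite !ltW.
have [_ h1] := rP _ (b1 _ ct); have [_ h2] := rP _ (b2 _ ct).
rewrite (deriveE _ dDf).
have -> : f (t *: v + (t *: w + a)) - f (t *: v + a) - f (t *: w + a) + f a =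
  dg c * t by rewrite -gE; ring.
(* The linear parts of ['D_v f] at the two points differ exactly by its derivative along [t *: w],
   so only two remainders are left. *)
have -> : dg c * t - t ^+ 2 * 'd ('D_v f) a w =
    t * (('D_v f (c *: v + (t *: w + a)) - 'D_v f a - 'd ('D_v f) a (c *: v + (t *: w + a) - a))
     - ('D_v f (c *: v + a) - 'D_v f a - 'd ('D_v f) a (c *: v + a - a))).
  rewrite addrA !addrK linearD !linearZ /= /GRing.scale /= /dg addrA; ring.
rewrite normrM (gtr0_norm t0) expr2 (mulrCA e) ler_pM2l //.
apply: le_trans (ler_normB _ _) _; apply: le_trans (lerD h1 h2) _.
rewrite -mulrDr; apply: (@le_trans _ _ (e / N * (t * N))).
  rewrite ler_pM2l //; apply: le_trans (lerD (n1 _ ct) (n2 _ ct)) _.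
  by rewrite -mulrDr ler_pM2l // /N; lra.
by rewrite mulrACA mulVf ?mulr1 ?gt_eqF.
Qed.

(** The second difference is symmetric in [v] and [w], and divided by [t ^+ 2] it tends to either
    mixed derivative. The first derivatives are only assumed differentiable at [a], as befits the
    function [p . Y_1], whose second derivatives are controlled at the base point alone. *)
Lemma schwarz f a v w :
  (\forall x \near a, differentiable f x) ->
  differentiable ('D_v f) a -> differentiable ('D_w f) a ->
  'D_w ('D_v f) a = 'D_v ('D_w f) a.
Proof.
move=> df dv dw; apply/eqP; rewrite -subr_eq0 -normr_le0; apply/ler_addgt0Pl => e e0.
rewrite addr0; have e2 : 0 < e / 2 by rewrite divr_gt0.
have [d1 d10 h1] := second_difference w e2 df dv.
have [d2 d20 h2] := second_difference v e2 df dw.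
pose t := Num.min d1 d2 / 2.
have d0 : 0 < Num.min d1 d2 by rewrite lt_min d10 d20.
have t0 : 0 < t by rewrite divr_gt0.
have td : t < Num.min d1 d2 by rewrite ltr_pdivrMr // ltr_pMr // ltr1n.
have [td1 td2] : t < d1 /\ t < d2 by move: td; rewrite lt_min => /andP.
have t2 : 0 < t ^+ 2 by rewrite exprn_gt0.
have := h1 t t0 td1; have := h2 t t0 td2.
rewrite [t *: w + (t *: v + a)]addrCA => k2 k1.
rewrite -(ler_pM2r t2) -{1}(gtr0_norm t2) -normrM.
have aux (A B p q r s T E : R) : `|p - q - r + s - T * A| <= E * T ->
    `|p - r - q + s - T * B| <= E * T -> `|(A - B) * T| <= (E + E) * T.
  move=> hA hB.
  have -> : (A - B) * T = (p - r - q + s - T * B) - (p - q - r + s - T * A) by ring.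
  by rewrite mulrDl; apply: le_trans (ler_normB _ _) _; exact: lerD.
by rewrite [X in _ <= X * _]splitr; exact: aux k1 k2.
Qed.

End Schwarz.

(** * Orthonormal frames, the stretch of an isometry, and eigenvalues on the tangent plane *)

Section OrthonormalFrames.
Context {R : realType}.
Implicit Types (u v w n e : 'cV[R]_3) (A F Q U : 'M[R]_3).

Definition orthonormal3 e1 e2 n : Prop :=
  [/\ dotv e1 e1 = 1, dotv e2 e2 = 1, dotv n n = 1, dotv e1 e2 = 0 &
      dotv n e1 = 0 /\ dotv n e2 = 0].

(** Both [n] and [w] are multiples of [crossv e1 e2], the former with a nonzero factor;
    orthogonality to [n] then kills [w]. *)
Lemma orthonormal3_eq0 e1 e2 n w : orthonormal3 e1 e2 n ->
  dotv w e1 = 0 -> dotv w e2 = 0 -> dotv n w = 0 -> w = 0.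
Proof.
move=> [e11 e22 nn e12 [ne1 ne2]] we1 we2 nw.
have cE v : dotv v e1 = 0 -> dotv v e2 = 0 -> v = dotv v (crossv e1 e2) *: crossv e1 e2.
  move=> ve1 ve2; have := cross_expand e1 e2 v.
  by rewrite lagrange e11 e22 e12 ve1 ve2 expr0n /= !mul0r !subr0 !scale0r !add0r mulr1 scale1r.
have nE := cE n ne1 ne2; have wE := cE w we1 we2.
have nc : dotv n (crossv e1 e2) != 0.
  by apply: contra_eq_neq nn => nc0; rewrite nE nc0 scale0r dotv0l eq_sym oner_eq0.
rewrite wE; move: nw; rewrite {1}wE dotvZr => /eqP; rewrite mulf_eq0 (negPf nc) orbF => /eqP ->.
by rewrite scale0r.
Qed.

Lemma orthonormal3_expand e1 e2 n v : orthonormal3 e1 e2 n -> dotv n v = 0 ->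
  v = dotv v e1 *: e1 + dotv v e2 *: e2.
Proof.
move=> oe nv; have [e11 e22 nn e12 [ne1 ne2]] := oe.
apply/eqP; rewrite -subr_eq0; apply/eqP; apply: (orthonormal3_eq0 oe);
  rewrite ?dotvBl ?dotvBr ?dotvDl ?dotvDr ?dotvZl ?dotvZr.
- by rewrite (dotvC e2 e1) e11 e12 mulr1 mulr0 addr0 subrr.
- by rewrite e22 e12 mulr1 mulr0 add0r subrr.
- by rewrite nv ne1 ne2 !mulr0 addr0 subr0.
Qed.

(** Equality case of Cauchy-Schwarz: by Lagrange's identity the difference of the two sides has
    squared length zero. *)
Lemma crossv_eq0 u v : crossv u v = 0 -> dotv v v *: u = dotv u v *: v.
Proof.
move=> c0; have := lagrange u v; rewrite c0 dotv0l => /esym l.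
apply/eqP; rewrite -subr_eq0; apply/eqP; apply: dotvv_eq0.
rewrite !(dotvBl, dotvBr, dotvZl, dotvZr) (dotvC v u).
rewrite (_ : _ - _ = dotv v v * (dotv u u * dotv v v - dotv u v ^+ 2)); last by ring.
by rewrite l mulr0.
Qed.

Lemma free2_crossv u v : free [:: u; v] = (crossv u v != 0).
Proof.
rewrite free_cons span_seq1 seq1_free; apply/idP/idP.
  move=> /andP[uv v0]; apply: contraNneq uv => /crossv_eq0 uv; apply/vlineP.
  exists (dotv u v / dotv v v); rewrite mulrC -scalerA -uv scalerA mulVf ?scale1r //.
  by rewrite gt_eqF // dotvv_gt0.
move=> c0; apply/andP; split; last first.
  by apply: contra_neq c0 => ->; apply: eq_cV3; rewrite crossvE !mxE; ring.
apply: contra_neqN c0 => /vlineP[k ->].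
by apply: eq_cV3; rewrite crossvE !mxE; ring.
Qed.

Lemma acos_inj0 (x : R) : -1 <= x <= 1 -> acos x = acos 0 -> x = 0.
Proof.
move=> x1 x0; rewrite -(@acosK R x) ?in_itv // x0 acosK // in_itv /=.
by rewrite lerN10 ler01.
Qed.

Lemma angle_orthogonal u v : u != 0 -> v != 0 -> angle u v = acos 0 -> dotv u v = 0.
Proof.
move=> u0 v0 uv; have nz w : w != 0 -> 0 < enorm w by move=> w0; rewrite sqrtr_gt0 dotvv_gt0.
have p0 : 0 < enorm u * enorm v by rewrite mulr_gt0 // nz.
have : dotv u v / (enorm u * enorm v) = 0.
  apply: acos_inj0 uv; rewrite -ler_norml normrM normfV (gtr0_norm p0) ler_pdivrMr // mul1r.
  rewrite -[leRHS]gtr0_norm // -ler_sqr ?nnegrE // !real_normK ?num_real //.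
  rewrite exprMn !enorm_sqr -subr_ge0 -lagrange; exact: dotvv_ge0.
by move/eqP; rewrite mulf_eq0 invr_eq0 (gt_eqF p0) orbF => /eqP.
Qed.

(* Preservation of right angles makes [U] a similarity of the tangent plane,
   and preservation of areas makes it an isometry of that plane. *)
Lemma isometric_stretch F Q U e1 e2 n : orthonormal3 e1 e2 n ->
  F = Q *m U -> Q^T *m Q = 1%:M -> U^T = U -> U *m n = 0 ->
  (forall v, dotv n v = 0 -> v != 0 -> 0 < dotv v (U *m v)) ->
  (forall u v, dotv n u = 0 -> dotv n v = 0 -> u != 0 -> v != 0 ->
     angle (F *m u) (F *m v) = angle u v) ->
  (forall u v, dotv n u = 0 -> dotv n v = 0 ->
     enorm (crossv (F *m u) (F *m v)) = enorm (crossv u v)) ->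
  forall v, dotv n v = 0 -> F *m v = Q *m v.
Proof.
move=> oe FE QQ UT Un Upos Fang Farea.
have [e11 e22 nn e12 [ne1 ne2]] := oe.
have FF u v : dotv (F *m u) (F *m v) = dotv (U *m u) (U *m v).
  by rewrite FE -!mulmxA dotv_trmx mulmxA QQ mul1mx.
have Fneq0 v : dotv n v = 0 -> v != 0 -> F *m v != 0.
  move=> nv v0; apply: contraTneq (Upos v nv v0) => Fv0.
  have Uv0 : U *m v = 0 by apply: dotvv_eq0; rewrite -FF Fv0 dotv0l.
  by rewrite Uv0 dotv0r ltxx.
have orth u v : dotv n u = 0 -> dotv n v = 0 -> u != 0 -> v != 0 -> dotv u v = 0 ->
    dotv (U *m u) (U *m v) = 0.
  move=> nu nv u0 v0 uv; rewrite -FF; apply: angle_orthogonal; try exact: Fneq0.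
  by rewrite Fang // /angle uv mul0r.
have neq0 w : dotv w w != 0 -> w != 0 by apply: contra_neq => ->; rewrite dotv0l.
have o12 : dotv (U *m e1) (U *m e2) = 0.
  by apply: orth => //; apply: neq0; rewrite ?e11 ?e22 oner_neq0.
(* The diagonals [e1 + e2] and [e1 - e2] of the unit square are orthogonal; that their images remain
   so forces [U *m e1] and [U *m e2] to have equal length. *)
have pq : dotv (U *m e1) (U *m e1) = dotv (U *m e2) (U *m e2).
  have : dotv (U *m (e1 + e2)) (U *m (e1 - e2)) = 0.
    apply: orth; rewrite ?dotvDr ?dotvNr ?ne1 ?ne2 ?oppr0 ?addr0 //.
    - apply: neq0; rewrite !(dotvDr, dotvDl) (dotvC e2 e1) e11 e22 e12 addr0 add0r.
      by rewrite gt_eqF // addr_gt0.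
    - apply: neq0; rewrite !(dotvDr, dotvDl, dotvNl, dotvNr) (dotvC e2 e1) e11 e22 e12.
      by rewrite oppr0 addr0 add0r opprK gt_eqF // addr_gt0.
    - by rewrite !dotvDl (dotvC e2 e1) e11 e22 e12 addr0 add0r subrr.
  rewrite mulmxDr mulmxBr !(dotvDr, dotvDl, dotvNl, dotvNr) (dotvC (U *m e2) (U *m e1)) o12.
  by rewrite oppr0 addr0 add0r => /subr0_eq.
have p1 : dotv (U *m e1) (U *m e1) = 1.
  have /(congr1 (fun x => x ^+ 2)) := Farea e1 e2 ne1 ne2.
  rewrite !enorm_sqr !lagrange !FF o12 e11 e22 e12 -pq expr0n /= !subr0 mulr1 -expr2.
  by move=> /eqP; rewrite sqrf_eq1 => /orP[/eqP //|/eqP p]; have := dotvv_ge0 (U *m e1); rewrite p; lra.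
have q1 := p1; rewrite pq in q1.
have UU v : dotv n v = 0 -> U *m (U *m v) = v.
  move=> nv; apply/eqP; rewrite -subr_eq0; apply/eqP.
  have vE := orthonormal3_expand oe nv.
  apply: (orthonormal3_eq0 oe); rewrite ?dotvBl ?dotvBr.
  - rewrite dotv_trmx UT {1}vE mulmxDr -!scalemxAr dotvDl !dotvZl p1 (dotvC (U *m e2)) o12.
    by rewrite mulr1 mulr0 addr0 subrr.
  - rewrite dotv_trmx UT {1}vE mulmxDr -!scalemxAr dotvDl !dotvZl q1 o12.
    by rewrite mulr1 mulr0 add0r subrr.
  - by rewrite dotvC dotv_trmx UT Un dotv0r nv subr0.
move=> v nv; rewrite FE -mulmxA; congr (_ *m _); apply/eqP; rewrite -subr_eq0; apply/negP => /negP w0.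
(* As [U] is an involution on the tangent plane, [U *m v - v] is an eigenvector for -1 unless it
   vanishes, against positivity. *)
have Uw : U *m (U *m v - v) = - (U *m v - v) by rewrite mulmxBr UU // opprB.
have nw : dotv n (U *m v - v) = 0.
  by rewrite dotvBr nv subr0 dotvC dotv_trmx UT Un dotv0r.
by have := Upos _ nw w0; rewrite Uw dotvNr oppr_gt0 ltNge dotvv_ge0.
Qed.

Lemma crossv_lincomb (a1 b1 a2 b2 : R) u v :
  crossv (a1 *: u + b1 *: v) (a2 *: u + b2 *: v) = (a1 * b2 - a2 * b1) *: crossv u v.
Proof. by apply: eq_cV3; rewrite !mxE ?ord3E ?add0r; ring. Qed.

(** For [b = 0] the basis is already diagonal. Otherwise the eigenvalues are the roots of the
    characteristic polynomial with discriminant [s ^+ 2], and [b *: e1 + (k - a) *: e2] is an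
    eigenvector for the root [k]. *)
Lemma symmetric_eigenbasis A e1 e2 n a b c : orthonormal3 e1 e2 n ->
  A *m e1 = a *: e1 + b *: e2 -> A *m e2 = b *: e1 + c *: e2 ->
  exists k1 k2 u1 u2, [/\ dotv n u1 = 0, dotv n u2 = 0, free [:: u1; u2],
    A *m u1 = k1 *: u1 & A *m u2 = k2 *: u2].
Proof.
move=> [e11 e22 nn e12 [ne1 ne2]] Ae1 Ae2.
have c0 : crossv e1 e2 != 0.
  apply: contra_eq_neq (lagrange e1 e2) => ->; rewrite dotv0l e11 e22 e12 expr0n /= subr0 mulr1.
  by rewrite eq_sym oner_eq0.
have [b0|b0] := eqVneq b 0.
  exists a, c, e1, e2; split; rewrite ?free2_crossv //.
    by rewrite Ae1 b0 scale0r addr0.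
  by rewrite Ae2 b0 scale0r add0r.
pose s := Num.sqrt ((a - c) ^+ 2 + 4 * b ^+ 2).
have b2 : 0 < b ^+ 2 by rewrite exprn_even_gt0.
have D0 : 0 < (a - c) ^+ 2 + 4 * b ^+ 2 by rewrite ltr_wpDl ?sqr_ge0 // mulr_gt0.
have s0 : 0 < s by rewrite sqrtr_gt0.
have s2 : s ^+ 2 = (a - c) ^+ 2 + 4 * b ^+ 2 by rewrite sqr_sqrtr // ltW.
pose ev k := b *: e1 + (k - a) *: e2.
have Aev k : (2 * k - (a + c)) ^+ 2 = s ^+ 2 -> A *m ev k = k *: ev k.
  rewrite s2 => ks; rewrite /ev mulmxDr -!scalemxAr Ae1 Ae2 !scalerDr !scalerA addrACA -!scalerDl.
  by congr (_ *: _ + _ *: _); [ring|lra].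
have nev k : dotv n (ev k) = 0 by rewrite dotvDr !dotvZr ne1 ne2 !mulr0 addr0.
exists ((a + c + s) / 2), ((a + c - s) / 2), (ev ((a + c + s) / 2)), (ev ((a + c - s) / 2)).
split; rewrite ?nev //.
- rewrite free2_crossv crossv_lincomb scaler_eq0 negb_or c0 andbT.
  rewrite (_ : b * _ - b * _ = - (b * s)); last by field.
  by rewrite oppr_eq0 mulf_neq0 // gt_eqF.
- by apply: Aev; field.
- by apply: Aev; field.
Qed.

(** Applying [A] to both factors of [crossv u1 u2] multiplies it by [k1 * k2] on the one hand and by
    the determinant on the other. Hence the product of principal curvatures does not depend on the
    eigenbasis chosen. *)
Lemma eigenbasis_det A e1 e2 n a b c k1 k2 u1 u2 : orthonormal3 e1 e2 n ->
  A *m e1 = a *: e1 + b *: e2 -> A *m e2 = b *: e1 + c *: e2 ->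
  dotv n u1 = 0 -> dotv n u2 = 0 -> free [:: u1; u2] ->
  A *m u1 = k1 *: u1 -> A *m u2 = k2 *: u2 -> k1 * k2 = a * c - b ^+ 2.
Proof.
move=> oe Ae1 Ae2 nu1 nu2; rewrite free2_crossv => c0 Au1 Au2.
suff /eqP : (k1 * k2 - (a * c - b ^+ 2)) *: crossv u1 u2 = 0.
  by rewrite scaler_eq0 (negPf c0) orbF subr_eq0 => /eqP.
apply/eqP; rewrite scalerBl subr_eq0; apply/eqP.
have -> : (k1 * k2) *: crossv u1 u2 = crossv (A *m u1) (A *m u2).
  by rewrite Au1 Au2; apply: eq_cV3; rewrite !mxE ?ord3E ?add0r; ring.
have AE x y : A *m (x *: e1 + y *: e2) = (x * a + y * b) *: e1 + (x * b + y * c) *: e2.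
  by rewrite mulmxDr -!scalemxAr Ae1 Ae2 !scalerDr !scalerA addrACA -!scalerDl.
rewrite (orthonormal3_expand oe nu1) (orthonormal3_expand oe nu2) !AE.
by rewrite !crossv_lincomb scalerA; congr (_ *: _); ring.
Qed.

End OrthonormalFrames.

(** * Gaussian curvature through the second fundamental form *)

Section SecondFundamentalForm.
Context {R : realType}.
Implicit Types (S : set 'cV[R]_3) (U : set 'cV[R]_2) (X : 'cV[R]_2 -> 'cV[R]_3).

(** The coordinate tangent vectors [a], [b] are independent and [n] is parallel to [crossv a b]; a
    vector orthogonal to [n] thus has no component along [crossv a b] and expands in [a] and [b]. *)
Lemma parametrization_normal S U X u n w : parametrization S U X -> U u ->
  n != 0 -> (forall v, dotv n ('d X u v) = 0) -> dotv n w = 0 ->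
  exists v, 'd X u v = w.
Proof.
move=> [_ _ _ immX _] Uu n0 nX nw.
pose d0 : 'cV[R]_2 := delta_mx 0 0; pose d1 : 'cV[R]_2 := delta_mx 1 0.
pose a := 'd X u d0; pose b := 'd X u d1.
have b0 : b != 0.
  apply/eqP => /(immX u Uu) /matrixP /(_ 1 0); rewrite !mxE /=; apply/eqP.
  exact: oner_neq0.
have c0 : crossv a b != 0.
  apply/eqP => /crossv_eq0 /eqP; rewrite -subr_eq0 /a /b -!linearZ -linearB => /eqP.
  move=> /(immX u Uu) /matrixP /(_ 0 0); rewrite !mxE /= mulr1 mulr0 subr0; apply/eqP.
  by rewrite gt_eqF // dotvv_gt0.
have cc : dotv (crossv a b) (crossv a b) != 0 by rewrite gt_eqF // dotvv_gt0.
have nE := cross_expand a b n; rewrite !nX !mul0r subrr !scale0r !add0r in nE.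
have nc : dotv n (crossv a b) != 0.
  apply: contra_neq n0 => nc; move/eqP: nE; rewrite nc scale0r scaler_eq0 (negPf cc) /=.
  by move/eqP.
have wc : dotv w (crossv a b) = 0.
  have /(congr1 (fun z => dotv z w)) := nE; rewrite !dotvZl nw mulr0 => /esym/eqP.
  by rewrite mulf_eq0 (negPf nc) dotvC => /eqP.
have := cross_expand a b w; rewrite wc scale0r addr0 /a /b -!linearZ -linearD -/a -/b.
set v : 'cV[R]_2 := _ *: d0 + _ => wE; exists ((dotv (crossv a b) (crossv a b))^-1 *: v).
by rewrite linearZ /= -wE scalerA mulVf // scale1r.
Qed.

Lemma tangent_normalE S U X u n w : parametrization S U X -> U u ->
  dotv n n = 1 -> (forall v, dotv n ('d X u v) = 0) ->
  tangent S (X u) w <-> dotv n w = 0.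
Proof.
move=> pX Uu nn nX; rewrite (tangentE pX Uu); split => [[v _ <-] //|nw].
have n0 : n != 0 by apply: contra_eq_neq nn => ->; rewrite dotv0l eq_sym oner_eq0.
by have [v <-] := parametrization_normal pX Uu n0 nX nw; exists v.
Qed.

Lemma derive_symmetric (V : normedModType R) (f : V -> 'cV[R]_3) a v w :
  (\forall x \near a, differentiable f x) ->
  differentiable ('D_v f) a -> differentiable ('D_w f) a ->
  'D_w ('D_v f) a = 'D_v ('D_w f) a.
Proof.
move=> df dv dw; apply/matrixP => i j.
have E z : \forall x \near a, 'D_z f x i j = 'D_z (fun x => f x i j) x.
  apply: filterS df => x dfx.
  by have [_ ->] := derivable_entry i j (@diff_derivable _ _ _ _ _ z dfx).
have D1 z : differentiable ('D_z f) a -> differentiable ('D_z (fun x => f x i j)) a.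
  by move=> dz; apply: (near_eq_differentiable (E z) _).1; exact: differentiable_entry.
have D2 y z : differentiable ('D_z f) a ->
    'D_y ('D_z f) a i j = 'D_y ('D_z (fun x => f x i j)) a.
  move=> dz; have [_ <-] := derivable_entry i j (@diff_derivable _ _ _ _ _ y dz).
  exact: near_eq_derive.
refine (etrans (D2 w v dv) (etrans _ (esym (D2 v w dw)))).
refine (schwarz _ (D1 v dv) (D1 w dw)).
by apply: filterS df => x; exact: differentiable_entry.
Qed.

Lemma derive_dotv_cst (V : normedModType R) (f g : V -> 'cV[R]_3) a v (k : R) :
  derivable f a v -> derivable g a v -> (\forall x \near a, dotv (f x) (g x) = k) ->
  dotv ('D_v f a) (g a) + dotv (f a) ('D_v g a) = 0.
Proof.
move=> df dg fg; have [_ <-] := is_derive_dotv df dg.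
have kfg : \forall x \near a, (cst k : V -> R) x = dotv (f x) (g x).
  by apply: filterS fg => x /= ->.
by have [_] := near_eq_is_derive kfg (is_derive_cst (k : R) a v).
Qed.

Definition second_form (n : 'cV[R]_3) X (u v w : 'cV[R]_2) : R :=
  dotv n ('D_w ('D_v X) u).

(* With respect to an orthonormal tangent basis the curvature tensor is minus
   the second fundamental form. *)
Lemma gaussian_curvature_second_form S U X u n v1 v2 :
  parametrization S U X -> U u -> classC 2 U X ->
  (forall x, U x -> dotv (n (X x)) (n (X x)) = 1) ->
  (forall x v, U x -> dotv (n (X x)) ('d X x v) = 0) ->
  differentiable (n \o X) u ->
  orthonormal3 ('d X u v1) ('d X u v2) (n (X u)) ->
  gaussian_curvature S n (X u) =
    second_form (n (X u)) X u v1 v1 * second_form (n (X u)) X u v2 v2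
    - second_form (n (X u)) X u v1 v2 ^+ 2.
Proof.
move=> pX Uu [dX DX] nn nX dnX oe.
have [oU _ _ _ _] := pX.
have nU : \forall x \near u, U x by exact: open_nbhs_nbhs.
have ndX : \forall x \near u, differentiable X x by apply: filterS nU.
have sgP := is_sgradP pX Uu (fun v => nX u v Uu) dnX.
have [lin_sg _ _] := sgP.
have AE v : curvature_tensor S n (X u) *m 'd X u v = 'D_v (n \o X) u.
  by rewrite sgrad_mxE // (sgrad_param pX Uu _ dnX) // => w; exact: nX.
have dnv v : derivable (n \o X) u v by exact: diff_derivable.
have nnv v : dotv (n (X u)) ('D_v (n \o X) u) = 0.
  have n1 : \forall x \near u, dotv ((n \o X) x) ((n \o X) x) = 1.
    by apply: filterS nU => x; exact: nn.
  have := derive_dotv_cst (dnv v) (dnv v) n1.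
  by rewrite [X in X + _]dotvC -mulr2n => /eqP; rewrite mulrn_eq0 => /eqP.
(* Weingarten's equation, from differentiating the relation that the normal is orthogonal to
   ['D_w X]. *)
have nvX v w : dotv ('D_v (n \o X) u) ('d X u w) = - second_form (n (X u)) X u w v.
  have dDX : derivable ('D_w X) u v by apply: diff_derivable; exact: (DX w).1.
  have := derive_dotv_cst (k := 0) (dnv v) dDX; rewrite [('D_w X) u]deriveE; last exact: dX.
  move=> /= h; apply/eqP; rewrite -addr_eq0; apply/eqP/h; apply: filterS nU => x Ux.
  by rewrite deriveE ?nX //; exact: dX.
have sym : second_form (n (X u)) X u v1 v2 = second_form (n (X u)) X u v2 v1.
  by rewrite /second_form derive_symmetric //; exact: (DX _).1.
have Ae1 : curvature_tensor S n (X u) *m 'd X u v1 =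
    - second_form (n (X u)) X u v1 v1 *: 'd X u v1 - second_form (n (X u)) X u v1 v2 *: 'd X u v2.
  by rewrite AE {1}(orthonormal3_expand oe (nnv v1)) !nvX -sym -scaleNr.
have Ae2 : curvature_tensor S n (X u) *m 'd X u v2 =
    - second_form (n (X u)) X u v1 v2 *: 'd X u v1 - second_form (n (X u)) X u v2 v2 *: 'd X u v2.
  by rewrite AE {1}(orthonormal3_expand oe (nnv v2)) !nvX -scaleNr.
rewrite -scaleNr in Ae1; rewrite -scaleNr in Ae2.
have tanE w := tangent_normalE w pX Uu (nn u Uu) (fun v => nX u v Uu).
(* An eigenbasis exists, so the curvature is a genuine product and not the default 0 of [xget]. *)
have KE : [set K | exists k1 k2, principal_curvatures S n (X u) k1 k2 /\ K = k1 * k2] !=set0.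
  have [k1 [k2 [u1 [u2 [nu1 nu2 fr A1 A2]]]]] := symmetric_eigenbasis oe Ae1 Ae2.
  exists (k1 * k2), k1, k2; split; last by [].
  by exists u1, u2; split; [exact/tanE|exact/tanE|exact: fr|exact: A1|exact: A2].
rewrite /gaussian_curvature.
have [k1 [k2 [[u1 [u2 [/tanE nu1 /tanE nu2 fr A1 A2]]] ->]]] := @xgetPex _ 0 _ KE.
refine (etrans (eigenbasis_det oe Ae1 Ae2 nu1 nu2 fr A1 A2) _).
by rewrite mulrNN sqrrN.
Qed.

End SecondFundamentalForm.

(** * The Gauss equation for a C^2 surface isometric to a C^3 one *)

Section TheoremaEgregium.
Context {R : realType}.
Implicit Types (U : set 'cV[R]_2) (X Y : 'cV[R]_2 -> 'cV[R]_3).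

Lemma subr_exchange (p q r s : R) : p - q = r - s -> q - s = p - r.
Proof. by lra. Qed.

(** Here [c i j k] stands for a Christoffel symbol of the first kind and [c i j k + c j i k] for a
    derivative of the metric. The relations for (i,j,k) and (i,k,j) minus that for (j,k,i) leave
    twice [c i j k]. *)
Lemma koszul (T : Type) (c d : T -> T -> T -> R) :
  (forall i j k, c i j k = c i k j) -> (forall i j k, d i j k = d i k j) ->
  (forall i j k, c i j k + c j i k = d i j k + d j i k) ->
  forall i j k, c i j k = d i j k.
Proof.
move=> csym dsym cd i j k.
have := cd i j k; have := cd i k j; have := cd j k i.
rewrite (csym i k j) (csym k j i) (csym j k i) (csym k i j).
rewrite (dsym i k j) (dsym k j i) (dsym j k i) (dsym k i j).
by lra.
Qed.

Lemma ler_entry_norm m n (A : 'M[R]_(m, n)) i j : `|A i j| <= `|A|.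
Proof.
rewrite [leRHS]/Num.Def.normr /= mx_normrE.
exact: (le_bigmax _ (fun ij => `|A ij.1 ij.2|) (i, j)).
Qed.

(** The norm is the maximum norm, so each of the three products contributes one term. *)
Lemma ler_dotv (u v : 'cV[R]_3) : `|dotv u v| <= 3 * (`|u| * `|v|).
Proof.
have h i : `|u i 0 * v i 0| <= `|u| * `|v|.
  by rewrite normrM ler_pM // ler_entry_norm.
rewrite dotvE; apply: le_trans (ler_normD _ _) _.
have := lerD (le_trans (ler_normD (u 0 0 * v 0 0) (u 1 0 * v 1 0)) (lerD (h 0) (h 1))) (h 2).
by move/le_trans; apply; lra.
Qed.

(** Replacing [g] by the constant [g a] costs the product of [f], of order [x - a], with
    [g x - g a], which tends to 0. Continuity of [g] therefore suffices where [f] vanishes. *)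
Lemma differentiable_dotv_eq0 (V : normedModType R) (f g : V -> 'cV[R]_3) a v :
  differentiable f a -> f a = 0 -> {for a, continuous g} ->
  differentiable (fun x => dotv (f x) (g x)) a /\
  'D_v (fun x => dotv (f x) (g x)) a = dotv ('D_v f a) (g a).
Proof.
move=> df f0 cg.
pose h x := dotv (f x) (g a); pose k x := dotv (f x) (g x - g a).
have dh : differentiable h a by exact: differentiable_dotv.
have Dh : 'D_v h a = dotv ('D_v f a) (g a).
  have dfv : derivable f a v by exact: diff_derivable.
  have [_] := is_derive_dotv dfv (derivable_cst (g a) a v).
  by rewrite derive_cst dotv0r addr0.
have [K K0 fK] := linear_lipschitz (diff_continuous df).
have fle : \forall x \near a, `|f x| <= (K + 1) * `|x - a|.
  apply: filterS (differentiable_leP df ltr01) => x; rewrite f0 subr0 mul1r => fx.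
  rewrite -(subrK ('d f a (x - a)) (f x)); apply: le_trans (ler_normD _ _) _.
  by rewrite mulrDl mul1r addrC lerD // fK.
have [dk kE] : differentiable k a /\ 'd k a = 'd (cst 0 : V -> R) a :> (V -> R).
  apply: differentiable_le; first by apply: diff_continuous; exact: differentiable_cst.
  move=> e e0; have e1 : 0 < e / (3 * (K + 1)) by rewrite divr_gt0 // mulr_gt0 // addr_gt0.
  have gle : \forall x \near a, `|g x - g a| < e / (3 * (K + 1)).
    by move/cvgrPdist_lt : cg => /(_ _ e1); apply: filterS => x; rewrite distrC.
  apply: filterS2 fle gle => x fx gx.
  have -> : 'd (cst 0 : V -> R) a (x - a) = 0 by rewrite diff_cst.
  rewrite /k f0 dotv0l !subr0.
  apply: le_trans (ler_dotv _ _) _.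
  apply: (@le_trans _ _ (3 * ((K + 1) * `|x - a| * (e / (3 * (K + 1)))))).
    by rewrite ler_pM2l // ler_pM // ltW.
  rewrite (_ : 3 * _ = e * `|x - a|) //; field.
  by rewrite gt_eqF // addr_gt0.
have fgE : (fun x => dotv (f x) (g x)) = h + k.
  by apply/funext => x; rewrite -[RHS]/(h x + k x) /h /k dotvBr [RHS]addrC subrK.
split; first by rewrite fgE; exact: differentiableD.
have Dk : 'D_v k a = 0 by rewrite (deriveE v dk) kE diff_cst.
have dkv : derivable k a v by exact: diff_derivable.
have dhv : derivable h a v by exact: diff_derivable.
have [_ E] := is_deriveD (derivableP dhv) (derivableP dkv).
by rewrite fgE; refine (etrans E _); rewrite Dk Dh addr0.
Qed.

(** In coordinates this is [X_11 . X_22 - X_12 . X_12]; for smooth [X] it equals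
    [F_12 - E_22 / 2 - G_11 / 2] in the metric coefficients E, F, G. *)
Definition riemann X (u v w : 'cV[R]_2) : R :=
  dotv ('D_w ('D_w X) u) ('D_v ('D_v X) u) - dotv ('D_v ('D_w X) u) ('D_w ('D_v X) u).

(** For smooth [Y] the third derivatives in ['D_w a] and ['D_v b] would cancel. Freezing ['D_w Y] at
    its value [p] lets Schwarz's theorem for [phi] replace that cancellation. *)
Lemma riemann_christoffel U Y u v w (a b : 'cV[R]_2 -> R) : open U -> U u -> classC 2 U Y ->
  (forall x, U x -> a x = dotv ('D_w Y x) ('D_v ('D_v Y) x)) ->
  (forall x, U x -> b x = dotv ('D_w Y x) ('D_w ('D_v Y) x)) ->
  differentiable a u -> differentiable b u ->
  riemann Y u v w = 'D_w a u - 'D_v b u.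
Proof.
move=> oU Uu [dY DY] aE bE da db.
have nU : \forall x \near u, U x by exact: open_nbhs_nbhs.
pose p := 'D_w Y u; pose f x := 'D_w Y x - p.
have df : differentiable f u by apply: differentiableB => //; exact: (DY w).1.
have Df z : 'D_z f u = 'D_z ('D_w Y) u.
  have d1 : derivable ('D_w Y) u z by apply: diff_derivable; exact: (DY w).1.
  have [_ E] := is_deriveB (derivableP d1) (is_derive_cst p u z).
  exact: etrans E (subr0 _).
have f0 : f u = 0 by rewrite /f subrr.
pose phi x := dotv p ('D_v Y x).
have dphi x : U x -> differentiable phi x.
  by move=> Ux; apply: differentiable_dotv => //; exact: (DY v).1.
have Dphi z x : U x -> 'D_z phi x = dotv p ('D_z ('D_v Y) x).
  move=> Ux; have d1 : derivable ('D_v Y) x z by apply: diff_derivable; exact: (DY v).1.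
  have [_] := is_derive_dotv (derivable_cst p x z) d1.
  by rewrite derive_cst dotv0l add0r.
have key z (c : 'cV[R]_2 -> R) : (forall x, U x -> c x = dotv ('D_w Y x) ('D_z ('D_v Y) x)) ->
    differentiable c u -> differentiable ('D_z phi) u /\
    forall y, 'D_y ('D_z phi) u = 'D_y c u - dotv ('D_y ('D_w Y) u) ('D_z ('D_v Y) u).
  move=> cE dc.
  have cg : {for u, continuous ('D_z ('D_v Y))} by exact: (DY v).2.
  have dfg y := differentiable_dotv_eq0 y df f0 cg.
  have nE : \forall x \near u, c x - dotv (f x) ('D_z ('D_v Y) x) = 'D_z phi x.
    apply: filterS nU => x Ux; rewrite Dphi // cE // /f dotvBl.
    by rewrite opprB addrC subrK.
  have dcf : differentiable (fun x => c x - dotv (f x) ('D_z ('D_v Y) x)) u.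
    by apply: differentiableB => //; exact: (dfg 0).1.
  split; first exact: (near_eq_differentiable nE dcf).1.
  move=> y; have dcy : derivable c u y by exact: diff_derivable.
  have dfgy : derivable (fun x => dotv (f x) ('D_z ('D_v Y) x)) u y.
    by apply: diff_derivable; exact: (dfg 0).1.
  have [_ E] := is_deriveB (derivableP dcy) (derivableP dfgy).
  refine (etrans (esym (near_eq_derive _ nE)) (etrans E _)).
  by rewrite (dfg y).2 Df.
have [dv Dv] := key v a aE da; have [dw Dw] := key w b bE db.
have ndphi : \forall x \near u, differentiable phi x by apply: filterS nU.
have h := etrans (esym (Dv w)) (etrans (schwarz ndphi dv dw) (Dw v)).
exact: subr_exchange h.
Qed.

(* Koszul's formula: the metric determines the Christoffel symbols. *)
Lemma christoffel_metric U X Y u v1 v2 v3 : open U -> U u -> classC 2 U X -> classC 2 U Y ->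
  (forall x v w, U x -> dotv ('D_v Y x) ('D_w Y x) = dotv ('D_v X x) ('D_w X x)) ->
  dotv ('D_v1 Y u) ('D_v3 ('D_v2 Y) u) = dotv ('D_v1 X u) ('D_v3 ('D_v2 X) u).
Proof.
move=> oU Uu CX CY XY.
have nU : \forall x \near u, U x by exact: open_nbhs_nbhs.
have D1 (Z : 'cV[R]_2 -> 'cV[R]_3) v w : classC 2 U Z -> derivable ('D_v Z) u w.
  by move=> [_ DZ]; apply: diff_derivable; exact: (DZ v).1.
have sym (Z : 'cV[R]_2 -> 'cV[R]_3) v w : classC 2 U Z -> 'D_w ('D_v Z) u = 'D_v ('D_w Z) u.
  move=> [dZ DZ]; have nd : \forall x \near u, differentiable Z x by apply: filterS nU.
  exact: derive_symmetric nd ((DZ v).1 u Uu) ((DZ w).1 u Uu).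
pose c (Z : 'cV[R]_2 -> 'cV[R]_3) i j k := dotv ('D_i Z u) ('D_k ('D_j Z) u).
have csym Z i j k : classC 2 U Z -> c Z i j k = c Z i k j by move=> CZ; rewrite /c sym.
(* Each side is the derivative along [k] of the metric coefficient of [i] and [j]. *)
have G i j k : c Y i j k + c Y j i k = c X i j k + c X j i k.
  have GZ Z : classC 2 U Z -> 'D_k (fun x => dotv ('D_i Z x) ('D_j Z x)) u = c Z i j k + c Z j i k.
    move=> CZ; have [_ E] := is_derive_dotv (D1 Z i k CZ) (D1 Z j k CZ).
    by refine (etrans E _); rewrite addrC; congr (_ + _); exact: dotvC.
  refine (etrans (esym (GZ Y CY)) (etrans _ (GZ X CX))).
  by apply: near_eq_derive; apply: filterS nU => x; exact: XY.
exact: (koszul (fun i j k => csym Y i j k CY) (fun i j k => csym X i j k CX) G v1 v2 v3).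
Qed.

Lemma orthonormal3_parseval (e1 e2 n v w : 'cV[R]_3) : orthonormal3 e1 e2 n ->
  dotv v w = dotv e1 v * dotv e1 w + dotv e2 v * dotv e2 w + dotv n v * dotv n w.
Proof.
move=> oe; have [e11 e22 nn e12 [ne1 ne2]] := oe.
have nv : dotv n (v - dotv n v *: n) = 0 by rewrite dotvBr dotvZr nn mulr1 subrr.
have := orthonormal3_expand oe nv; rewrite !dotvBl !dotvZl ne1 ne2 !mulr0 !subr0.
move/eqP; rewrite subr_eq => /eqP {1}->.
by rewrite !dotvDl !dotvZl [dotv v e1]dotvC [dotv v e2]dotvC.
Qed.

(** Parseval's identity splits every scalar product into tangential and normal parts; the tangential
    components agree, so the last hypothesis reduces to its normal part. *)
Lemma second_form_det (e1 e2 n f1 f2 m A B C A' B' C' : 'cV[R]_3) :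
  orthonormal3 e1 e2 n -> orthonormal3 f1 f2 m ->
  dotv f1 A = dotv e1 A' -> dotv f2 A = dotv e2 A' ->
  dotv f1 B = dotv e1 B' -> dotv f2 B = dotv e2 B' ->
  dotv f1 C = dotv e1 C' -> dotv f2 C = dotv e2 C' ->
  dotv A B - dotv C C = dotv A' B' - dotv C' C' ->
  dotv m B * dotv m A - dotv m C ^+ 2 = dotv n B' * dotv n A' - dotv n C' ^+ 2.
Proof.
move=> oe of_ A1 A2 B1 B2 C1 C2.
rewrite (orthonormal3_parseval A B of_) (orthonormal3_parseval C C of_).
rewrite (orthonormal3_parseval A' B' oe) (orthonormal3_parseval C' C' oe).
by rewrite A1 A2 B1 B2 C1 C2; lra.
Qed.

Lemma theorema_egregium U X Y u v1 v2 (nx ny : 'cV[R]_3) : open U -> U u ->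
  classC 3 U X -> classC 2 U Y ->
  (forall x v w, U x -> dotv ('D_v Y x) ('D_w Y x) = dotv ('D_v X x) ('D_w X x)) ->
  orthonormal3 ('D_v1 X u) ('D_v2 X u) nx ->
  orthonormal3 ('D_v1 Y u) ('D_v2 Y u) ny ->
  second_form ny Y u v1 v1 * second_form ny Y u v2 v2 - second_form ny Y u v1 v2 ^+ 2 =
  second_form nx X u v1 v1 * second_form nx X u v2 v2 - second_form nx X u v1 v2 ^+ 2.
Proof.
move=> oU Uu C3X CY XY oX oY.
have nU : \forall x \near u, U x by exact: open_nbhs_nbhs.
have CX : classC 2 U X by exact: classC_le C3X.
have [_ DX] := C3X.
pose a i x := dotv ('D_v2 X x) ('D_i ('D_v1 X) x).
(* The C^3 regularity of [X] enters here; for [Y] the same functions are differentiable because the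
   metrics coincide. *)
have da i : differentiable (a i) u.
  by apply: differentiable_dotv; [exact: (DX v2).1|exact: ((DX v1).2 i).1].
have RX := riemann_christoffel oU Uu CX (fun x _ => erefl (a v1 x)) (fun x _ => erefl (a v2 x))
  (da v1) (da v2).
have aY i x : U x -> a i x = dotv ('D_v2 Y x) ('D_i ('D_v1 Y) x).
  by move=> Ux; rewrite /a (christoffel_metric v2 v1 i oU Ux CX CY XY).
have RY := riemann_christoffel oU Uu CY (aY v1) (aY v2) (da v1) (da v2).
have := etrans RY (esym RX).
have sym (Z : 'cV[R]_2 -> 'cV[R]_3) : classC 2 U Z -> 'D_v1 ('D_v2 Z) u = 'D_v2 ('D_v1 Z) u.
  move=> [dZ DZ]; have nd : \forall x \near u, differentiable Z x by apply: filterS nU.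
  exact: derive_symmetric nd ((DZ v2).1 u Uu) ((DZ v1).1 u Uu).
rewrite /riemann (sym Y CY) (sym X CX).
have k i j l := christoffel_metric i j l oU Uu CX CY XY.
move=> h; exact: (second_form_det oX oY (k _ _ _) (k _ _ _) (k _ _ _) (k _ _ _) (k _ _ _) (k _ _ _) h).
Qed.

End TheoremaEgregium.

(** * Open mapping for injective differentiable maps with injective differential *)

Section OpenMapping.
Context {R : realType} {n : nat}.
Implicit Types (p q : 'cV[R]_n) (f : 'cV[R]_n -> 'cV[R]_n).

(** The squared Euclidean norm is minimized because, unlike the maximum norm, it is
    differentiable. *)
Definition sumsq p : R := \sum_i p i 0 ^+ 2.

Lemma sumsq_ge0 p : 0 <= sumsq p.
Proof. by apply: sumr_ge0 => i _; exact: sqr_ge0. Qed.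

Lemma sumsq_eq0 p : sumsq p = 0 -> p = 0.
Proof.
move=> /eqP; rewrite psumr_eq0; last by move=> i _; exact: sqr_ge0.
move=> /allP p0; apply/matrixP => i j; rewrite (ord1 j) mxE.
by apply/eqP; rewrite -sqrf_eq0; apply: (p0 i); rewrite mem_index_enum.
Qed.

Lemma sumsqN p : sumsq (- p) = sumsq p.
Proof. by apply: eq_bigr => i _; rewrite mxE sqrrN. Qed.

Lemma sumsqD p q : sumsq (p + q) <= 2 * sumsq p + 2 * sumsq q.
Proof.
rewrite /sumsq !mulr_sumr -big_split; apply: ler_sum => i _; rewrite mxE /=.
by have := sqr_ge0 (p i 0 - q i 0); lra.
Qed.

Lemma differentiable_sumsq (V : normedModType R) (f : V -> 'cV[R]_n) a :
  differentiable f a -> differentiable (sumsq \o f) a.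
Proof.
move=> df; rewrite (_ : _ \o _ = \sum_(i < n) (fun y : V => f y i 0 * f y i 0)); last first.
  by apply/funext => x; rewrite fct_sumE; apply: eq_bigr => i _; rewrite expr2.
by apply: differentiable_sum => i; apply: differentiableM; exact: differentiable_entry.
Qed.

Lemma is_derive_sumsq (V : normedModType R) (f : V -> 'cV[R]_n) (a v : V) :
  derivable f a v ->
  is_derive a v (sumsq \o f) (\sum_i 2 * (f a i 0 * 'D_v f a i 0)).
Proof.
move=> df; rewrite (_ : _ \o _ = \sum_(i < n) (fun y : V => f y i 0 * f y i 0)); last first.
  by apply/funext => x; rewrite fct_sumE; apply: eq_bigr => i _; rewrite expr2.
apply: is_derive_sum => i; have dfi := derivable_entry i 0 df.
by apply: is_derive_eq; rewrite /GRing.scale /=; ring.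
Qed.

Lemma compact_gt0_bound (T : topologicalType) (K : set T) (g : T -> R) :
  compact K -> (forall x, K x -> {for x, continuous g}) -> (forall x, K x -> 0 < g x) ->
  exists2 m, 0 < m & forall x, K x -> m <= g x.
Proof.
move=> cK cg g0; have [KE|/set0P K0] := eqVneq K set0; first by exists 1 => // x; rewrite KE.
have [|c cK' cmin] := compact_EVT_min K0 cK (f := g).
  by apply: continuous_in_subspaceT => x /set_mem; exact: cg.
exists (g c); first by apply: g0; exact: set_mem.
by move=> x Kx; apply: cmin; exact: mem_set.
Qed.

Lemma compact_box (u : 'cV[R]_n) (r : R) : compact [set x : 'cV[R]_n | forall i, x i 0 \in `[u i 0 - r, u i 0 + r]].
Proof.
have cB : compact [set w : 'rV[R]_n | forall i, `[u i 0 - r, u i 0 + r]%classic (w ord0 i)].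
  apply: (@rV_compact _ _ (fun i => `[u i 0 - r, u i 0 + r]%classic)) => i.
  exact: segment_compact.
have ct : continuous (trmx : 'rV[R]_n -> 'cV[R]_n).
  move=> w; apply: differentiable_continuous; apply: differentiable_mx => i j.
  rewrite (_ : (fun _ => _) = (fun x : 'rV[R]_n => x j i)); first exact: differentiable_coord.
  by apply/funext => x; rewrite mxE.
have := @continuous_compact _ _ (trmx : 'rV[R]_n -> 'cV[R]_n) _ (continuous_subspaceT ct) cB.
congr (compact _); apply/seteqP; split => [_ [w wB <-] i|x xB]; first by rewrite mxE; exact: wB.
by exists x^T; rewrite ?trmxK // => i; rewrite mxE; exact: xB.
Qed.

(* The point whose image is closest to q lies in the interior of a box around
   u, where the differential of the squared distance vanishes. *)
Lemma open_mapping f u (W : set 'cV[R]_n) : nbhs u W -> set_inj W f ->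
  (forall x, W x -> differentiable f x) ->
  (forall x v, W x -> 'd f x v = 0 -> v = 0) ->
  nbhs (f u) (f @` W).
Proof.
move=> uW injf df immf; have Wu := nbhs_singleton uW.
have /nbhs_ballP[r2 /= r20 ballW] := uW; pose r := r2 / 2.
have r0 : 0 < r by rewrite divr_gt0.
pose B := [set x : 'cV[R]_n | forall i, x i 0 \in `[u i 0 - r, u i 0 + r]].
have cB : compact B by exact: compact_box.
have inB x : B x <-> (forall i, `|u i 0 - x i 0| <= r).
  split=> h i; have := h i; rewrite in_itv /= ler_distlC.
    by rewrite andbC => /andP[h1 h2]; apply/andP; split; lra.
  by move=> /andP[h1 h2]; apply/andP; split; lra.
have ballB : ball u r `<=` B.
  by move=> x [_ h]; apply/inB => i; apply/ltW; exact: h.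
have BW : B `<=` W.
  move=> x /inB h; apply: ballW; split => // i j; rewrite (ord1 j).
  by apply: le_lt_trans (h i) _; rewrite ltr_pdivrMr // ltr_pMr // ltr1n.
have dE x q : B x -> differentiable (sumsq \o (fun z => f z - q)) x.
  move=> /BW Wx; apply: differentiable_sumsq; apply: differentiableB => //.
  exact: df.
(* By injectivity and compactness the image of the box outside the open ball keeps a positive
   distance from [f u]. *)
have [m m0 mle] : exists2 m, 0 < m & forall x, B x -> ~ ball u r x -> m <= sumsq (f x - f u).
  have [|||m m0 mP] := @compact_gt0_bound _ (B `&` ~` ball u r) (sumsq \o (fun z => f z - f u)).
  - by apply: compact_closedI => //; apply: open_closedC; exact: ball_open.
  - by move=> x [Bx _]; exact: differentiable_continuous (dE _ _ Bx).
  - move=> x [Bx nb]; rewrite lt_neqAle sumsq_ge0 andbT eq_sym; apply/eqP => /sumsq_eq0.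
    move=> /subr0_eq fx; apply: nb; rewrite (injf x u) ?inE //; first exact: ballxx.
    exact: BW.
  - by exists m => // x Bx nb; exact: mP.
(* If the minimizer [b] lay outside the ball, then [m] would be at most [2 * sumsq (f b - q) + 2 *
   sumsq (q - f u)], hence at most four times the last [sumsq]; this explains [m / 4]. *)
have nq : \forall q \near f u, sumsq (q - f u) < m / 4.
  have dq : differentiable (sumsq \o (fun q => q - f u)) (f u).
    by apply: differentiable_sumsq; exact: differentiableB.
  have s0 : sumsq (f u - f u) = 0 by apply: big1 => i _; rewrite subrr mxE expr0n.
  have cq : sumsq (q - f u) @[q --> f u] --> sumsq (f u - f u).
    exact: differentiable_continuous dq.
  by move: cq; rewrite s0 => /cvgr_lt; apply; rewrite divr_gt0.
apply: filterS nq => q qm.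
have Bu : B u by apply: ballB; exact: ballxx.
have [|b bB bmin] := @compact_EVT_min _ _ (sumsq \o (fun z => f z - q)) B (ex_intro _ u Bu) cB.
  by apply: continuous_in_subspaceT => x /set_mem Bx; exact: differentiable_continuous (dE _ _ Bx).
have {}bB := set_mem bB.
have bu : ball u r b.
  apply: contrapT => nb; have := mle b bB nb.
  have uq : sumsq (f u - q) = sumsq (q - f u) by rewrite -sumsqN opprB.
  have := bmin u (mem_set Bu); rewrite /= uq.
  have := sumsqD (f b - q) (q - f u); rewrite addrA subrK.
  by move: (sumsq (f b - f u)) (sumsq (f b - q)) (sumsq (q - f u)) qm => *; lra.
have Wb := BW b bB.
exists b => //; apply/subr0_eq/sumsq_eq0.
have [J JE] := linear_cVP ('d f b).
have Ju : J \in unitmx by apply: injective_unitmx => v; rewrite -JE; exact: immf.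
(* Along this direction [f] moves by [f b - q] to first order, so the derivative of the squared
   distance is twice the squared distance itself; it vanishes at the minimum. *)
pose v := invmx J *m (f b - q).
have dfbq : derivable (fun z => f z - q) b v.
  by apply: diff_derivable; apply: differentiableB => //; exact: df.
have DE : 'D_v (fun z => f z - q) b = f b - q.
  have [_ E] := is_deriveB (derivableP (diff_derivable (df b Wb))) (is_derive_cst q b v).
  refine (etrans E _); rewrite subr0 deriveE ?JE ?mulKVmx //; exact: df.
have dg := is_derive_sumsq dfbq; rewrite DE in dg.
pose g (t : R^o) : R := (sumsq \o (fun z => f z - q)) (t *: v + b).
have nb : \forall t \near (0 : R^o), ball u r (t *: v + b).
  have dl := @ex_diff _ _ _ _ _ _ _ (is_diff_line b v 0).
  apply: (differentiable_continuous dl); rewrite scale0r add0r.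
  by apply: open_nbhs_nbhs; split => //; exact: ball_open.
have /nbhs_ballP[d /= d0 db] := nb.
have {}db t : t \in `]-d, d[ -> B (t *: v + b).
  rewrite in_itv /= => td; apply: ballB; apply: db.
  by rewrite -ball_normE /= sub0r normrN ltr_norml.
have dd : - d < d by lra.
have g1 : is_derive (0 : R^o) (1 : R^o) g 0.
  apply: (@derive1_at_min _ g (- d) d 0) => [|t td||t td].
  - by rewrite ltW.
  - by have [] := is_derive_along (dE _ q (db t td)).
  - by rewrite in_itv /= oppr_lt0 d0.
  - by rewrite /g scale0r add0r; apply: bmin; apply/mem_set; exact: db.
have [_ g3] := g1; move/is_derive_line: dg => [_ g2].
have := etrans (esym g2) g3; rewrite -mulr_sumr => /eqP; rewrite mulf_eq0 pnatr_eq0 /= => /eqP s0.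
by rewrite -s0; apply: eq_bigr => i _; rewrite expr2.
Qed.

End OpenMapping.

(** * The image parametrization and differentiability of unit normals *)

Section IsometricImage.
Context {R : realType}.
Implicit Types (S : set 'cV[R]_3) (U : set 'cV[R]_2) (X : 'cV[R]_2 -> 'cV[R]_3).

Lemma parametrization_image S U X (y : 'cV[R]_3 -> 'cV[R]_3) k :
  parametrization S U X -> surface k.+1 (y @` S) -> set_inj S y -> classC 1 U (y \o X) ->
  (forall u, U u -> forall v, 'd (y \o X) u v = 0 -> v = 0) ->
  parametrization (y @` S) U (y \o X).
Proof.
move=> [oU injX _ _ homX] surf injy CY immY.
have SX u : U u -> S (X u) by move=> Uu; exact: (homX u Uu).1.
have injY : set_inj U (y \o X).
  move=> u v /set_mem Uu /set_mem Uv yXuv; apply: injX; rewrite ?inE //.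
  by apply: injy; rewrite ?inE //; exact: SX.
split => // u Uu; have SYu : (y @` S) ((y \o X) u) by exists (X u) => //; exact: SX.
split => // V uV.
have [W [Z [/chart_parametrization pZ [w0 Ww0 Zw0]]]] := surf _ SYu.
have [oW injZ [dZ _] _ homZ] := pZ.
have dY x : U x -> differentiable (y \o X) x by exact: CY.1.
have nSY x : U x -> \forall t \near x, (y @` S) ((y \o X) t).
  move=> Ux; apply: filterS (open_nbhs_nbhs (conj oU Ux)) => t Ut.
  by exists (X t) => //; exact: SX.
have [psi [psiu _ Zpsi]] := parametrization_lift pZ Ww0 (esym Zw0) (dY u Uu) (nSY u Uu).
pose P := [set t | W (psi t) /\ Z (psi t) = (y \o X) t].
pose G := P^° `&` U `&` V^°.
have oG : open G by apply: openI; [apply: openI|]; rewrite //; exact: open_interior.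
have Gu : G u by split; [split|].
have GP t : G t -> P t by move=> [[Pt _] _]; exact: interior_subset.
have dpsi t : G t -> differentiable psi t.
  move=> Gt; have [Wt Zt] := GP t Gt; have Ut : U t by case: Gt => [[]].
  (* The lift [psi] is known to be differentiable at [u] only. Lifting afresh at [t] gives a map
     differentiable there, which agrees with [psi] nearby because [Z] is injective. *)
  have [psi' [_ dpsi' Zpsi']] := parametrization_lift pZ Wt (esym Zt) (dY t Ut) (nSY t Ut).
  have E : \forall s \near t, psi' s = psi s.
    apply: filterS2 Zpsi' (open_nbhs_nbhs (conj oG Gt)) => s [Ws Zs] /GP[Ws' Zs'].
    by apply: injZ; rewrite ?inE // Zs Zs'.
  exact: (near_eq_differentiable E dpsi').1.
have dpsi_inj t v : G t -> 'd psi t v = 0 -> v = 0.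
  move=> Gt psiv; have [Wt _] := GP t Gt; have Ut : U t by case: Gt => [[]].
  have E : \forall s \near t, (Z \o psi) s = (y \o X) s.
    by apply: filterS (open_nbhs_nbhs (conj oG Gt)) => s /GP[].
  have dZpsi : differentiable (Z \o psi) t.
    by apply: differentiable_comp; [exact: dpsi|exact: dZ].
  apply: (immY t Ut); rewrite (near_eq_differentiable E dZpsi).2 diff_comp /=.
  - by rewrite psiv linear0.
  - exact: dpsi.
  - exact: dZ.
have psi_inj : set_inj G psi.
  move=> s t /set_mem Gs /set_mem Gt st; apply: injY; rewrite ?inE.
  - by case: Gs => [[]].
  - by case: Gt => [[]].
  by have [_ <-] := GP s Gs; have [_ <-] := GP t Gt; rewrite st.
have := open_mapping (open_nbhs_nbhs (conj oG Gu)) psi_inj dpsi dpsi_inj.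
rewrite psiu => /(homZ w0 Ww0).2; rewrite Zw0; apply: filterS => p pP Sp.
have [w [[t Gt <-] _] <-] := pP Sp; have [_ Zt] := GP t Gt.
by exists t => //; case: Gt => [[_ Ut] /interior_subset Vt].
Qed.

Lemma det2 (B : 'M[R]_2) : \det B = B 0 0 * B 1 1 - B 1 0 * B 0 1.
Proof.
rewrite (expand_det_col B 0) !big_ord_recl big_ord0 addr0 /cofactor !det_mx11 !mxE /=.
have -> : lift ord0 ord0 = 1 :> 'I_2 by apply: val_inj.
have -> : lift 1 0 = 0 :> 'I_2 by apply: val_inj.
by rewrite expr0 expr1; ring.
Qed.

Lemma det3 (A : 'M[R]_3) : \det A = dotv (col 0 A) (crossv (col 1 A) (col 2 A)).
Proof.
rewrite (expand_det_col A 0) sum3 /cofactor !det2 dotvE !crossvE !mxE.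
have -> : lift (0 : 'I_3) (0 : 'I_2) = 1 by apply: val_inj.
have -> : lift (0 : 'I_3) (1 : 'I_2) = 2 by apply: val_inj.
have -> : lift (1 : 'I_3) (0 : 'I_2) = 0 by apply: val_inj.
have -> : lift (1 : 'I_3) (1 : 'I_2) = 2 by apply: val_inj.
have -> : lift (2 : 'I_3) (0 : 'I_2) = 0 by apply: val_inj.
have -> : lift (2 : 'I_3) (1 : 'I_2) = 1 by apply: val_inj.
by rewrite /= expr0 expr1 sqrrN expr1n; ring.
Qed.

Lemma dotv_crossv_det (A : 'M[R]_3) u v w :
  dotv (A *m u) (crossv (A *m v) (A *m w)) = \det A * dotv u (crossv v w).
Proof.
pose M : 'M[R]_3 := \matrix_(i, j) (if j == 0 then u i 0 else if j == 1 then v i 0 else w i 0).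
have cM : ((col 0 M = u) * (col 1 M = v) * (col 2 M = w))%type.
  by do !split; apply: eq_cV3; rewrite !mxE.
have := det3 M; rewrite !cM => <-; rewrite -det_mulmx det3.
by rewrite !colE -!mulmxA -!colE !cM.
Qed.

Lemma differentiable_scale (V : normedModType R) (k : V -> R) (f : V -> 'cV[R]_3) a :
  differentiable k a -> differentiable f a -> differentiable (fun x => k x *: f x) a.
Proof.
move=> dk df; apply: differentiable_mx => i j; under eq_fun do rewrite mxE.
by apply: differentiableM => //; exact: differentiable_entry.
Qed.

Lemma orthogonal_triple (m a b : 'cV[R]_3) : dotv m a = 0 -> dotv m b = 0 ->
  dotv (crossv a b) (crossv a b) *: m = dotv m (crossv a b) *: crossv a b.
Proof.
by move=> ma mb; rewrite cross_expand ma mb !mul0r subrr !scale0r !add0r.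
Qed.

(** Near [u] the field [m] is its triple product with [a] and [b], divided by the squared length of
    [crossv a b], times [crossv a b]. *)
Lemma normal_differentiable (V : normedModType R) (m a b : V -> 'cV[R]_3) u :
  differentiable a u -> differentiable b u -> crossv (a u) (b u) != 0 ->
  (\forall x \near u, dotv (m x) (a x) = 0 /\ dotv (m x) (b x) = 0) ->
  differentiable (fun x => dotv (m x) (crossv (a x) (b x))) u -> differentiable m u.
Proof.
move=> da db ab0 mab dr; have dN := differentiable_crossv da db.
have dNN := differentiable_dotv dN dN.
have NN0 : dotv (crossv (a u) (b u)) (crossv (a u) (b u)) != 0 by rewrite gt_eqF // dotvv_gt0.
have dk := differentiableM dr (differentiableV dNN NN0).
have nNN : \forall x \near u, 0 < dotv (crossv (a x) (b x)) (crossv (a x) (b x)).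
  by move/cvgr_gt : (differentiable_continuous dNN); apply; exact: dotvv_gt0.
apply: (near_eq_differentiable _ (differentiable_scale dk dN)).1.
apply: filterS2 nNN mab => x NN [ma mb].
rewrite -[X in X *: _]/(dotv (m x) (crossv (a x) (b x)) *
  (dotv (crossv (a x) (b x)) (crossv (a x) (b x)))^-1).
by rewrite mulrC -scalerA -orthogonal_triple // scalerA mulVf ?scale1r // gt_eqF.
Qed.

(* A continuous unit normal is a locally constant sign times the normalized
   cross product of the coordinate tangent vectors. *)
Lemma unit_normal_triple_differentiable (V : normedModType R) (m a b : V -> 'cV[R]_3) u :
  {for u, continuous m} -> differentiable a u -> differentiable b u ->
  crossv (a u) (b u) != 0 ->
  (\forall x \near u, [/\ dotv (m x) (m x) = 1, dotv (m x) (a x) = 0 & dotv (m x) (b x) = 0]) ->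
  differentiable (fun x => dotv (m x) (crossv (a x) (b x))) u.
Proof.
move=> cm da db ab0 mab; have dN := differentiable_crossv da db.
have dNN := differentiable_dotv dN dN.
set r := fun x => dotv (m x) (crossv (a x) (b x)).
set NN := (fun x => dotv (crossv (a x) (b x)) (crossv (a x) (b x))) in dNN.
have NN0 : 0 < NN u by exact: dotvv_gt0.
have rr : \forall x \near u, r x ^+ 2 = NN x.
  apply: filterS mab => x [mm ma mb]; rewrite expr2 /r -dotvZl -[RHS]mulr1 -mm.
  rewrite -[RHS]dotvZl orthogonal_triple // !dotvZl; congr (_ * _); exact: dotvC.
have cr : {for u, continuous r}.
  have ce i : {for u, continuous (fun x => m x i 0)}.
    apply: (@continuous_comp _ _ _ m (fun A : 'cV[R]_3 => A i 0) u cm).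
    exact: coord_continuous.
  have cn i : {for u, continuous (fun x => crossv (a x) (b x) i 0)}.
    by apply: differentiable_continuous; exact: differentiable_entry.
  pose t i x := m x i 0 * crossv (a x) (b x) i 0.
  have ct i : {for u, continuous (t i)} by apply: (@cvgM _ _ (nbhs u)); [exact: ce|exact: cn].
  have -> : r = (fun x => t 0 x + t 1 x + t 2 x) by apply/funext => x; exact: dotvE.
  apply: (@cvgD _ _ _ (nbhs u)); last exact: ct.
  by apply: (@cvgD _ _ _ (nbhs u)); exact: ct.
have dsq : differentiable (Num.sqrt \o NN) u.
  apply: differentiable_comp => //; apply/derivable1_diffP.
  by have [] := is_derive1_sqrt NN0.
have r0 : r u != 0 by rewrite -sqrf_eq0 (nbhs_singleton rr) gt_eqF.
have [ru|ru|ru] := ltgtP (r u) 0; last by rewrite ru eqxx in r0.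
- have nr : \forall x \near u, r x < 0 by move/cvgr_lt : cr; apply.
  apply: (near_eq_differentiable _ (differentiableN dsq)).1.
  by apply: filterS2 rr nr => x /= rx r0x; rewrite -[LHS]/(- Num.sqrt (NN x)) -rx sqrtr_sqr ltr0_norm ?opprK.
- have nr : \forall x \near u, 0 < r x by move/cvgr_gt : cr; apply.
  apply: (near_eq_differentiable _ dsq).1.
  by apply: filterS2 rr nr => x /= rx r0x; rewrite -rx sqrtr_sqr gtr0_norm.
Qed.

Lemma within_comp_continuous S U X (nu : 'cV[R]_3 -> 'cV[R]_3) u : parametrization S U X -> U u ->
  {within S, continuous nu} -> {for u, continuous (nu \o X)}.
Proof.
move=> [oU _ [dX _] _ homX] Uu /subspace_continuousP cnu.
have Xw : X x @[x --> u] --> within S (nbhs (X u)).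
  move=> P; rewrite /within /= => SP.
  have cX : X x @[x --> u] --> X u by exact: differentiable_continuous (dX u Uu).
  have nP : \forall x \near u, S (X x) -> P (X x) by exact: cX SP.
  have nU : \forall x \near u, U x by exact: open_nbhs_nbhs.
  by apply: filterS2 nU nP => x Ux; apply; exact: (homX x Ux).1.
exact: cvg_trans (cvg_app nu Xw) (cnu _ (homX u Uu).1).
Qed.

End IsometricImage.

(** * Symmetry of the rotation gradient and its axial component *)

Section RotationGradient.
Context {R : realType}.

Lemma moving_frame_orthonormal (S : set 'cV[R]_3) (nu e1 e2 : 'cV[R]_3 -> 'cV[R]_3) x :
  unit_normal S nu -> moving_frame S nu e1 e2 -> S x -> orthonormal3 (e1 x) (e2 x) (nu x).
Proof.
move=> [_ nuP] frame Sx; have [/enorm1 nn _] := nuP x Sx.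
have [/enorm1 e11 /enorm1 e22 e12 [e1n e2n] _] := frame x Sx.
by split => //; rewrite ![dotv (nu x) _]dotvC.
Qed.

Lemma orthonormal3_mul (A : 'M[R]_3) (e1 e2 n : 'cV[R]_3) : A^T *m A = 1%:M ->
  orthonormal3 e1 e2 n -> orthonormal3 (A *m e1) (A *m e2) (A *m n).
Proof.
move=> AA; have dA u v : dotv (A *m u) (A *m v) = dotv u v.
  by rewrite dotv_trmx mulmxA AA mul1mx.
by rewrite /orthonormal3 !dA.
Qed.

(* Equality of mixed derivatives of the chart and of its image: the derivative
   of [D_v (y o X) = Q D_v X] along w is symmetric in v and w. *)
Lemma rotation_gradient_symmetric (S : set 'cV[R]_3) nu (Q : 'cV[R]_3 -> 'M[R]_3)
    U (X Y : 'cV[R]_2 -> 'cV[R]_3) u v w :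
  parametrization S U X -> U u -> classC 2 U X -> classC 2 U Y ->
  (forall z x, U x -> 'D_z Y x = Q (X x) *m 'D_z X x) ->
  sgrad S nu Q (X u) ('d X u v) *m 'd X u w = sgrad S nu Q (X u) ('d X u w) *m 'd X u v.
Proof.
move=> pX Uu CX CY YX; have [oU _ _ _ _] := pX.
have nU : \forall x \near u, U x by exact: open_nbhs_nbhs.
(* If no gradient of [Q] exists, [sgrad] is zero by convention and both sides vanish. *)
have [exG|noG] := pselect (exists G, is_sgrad S nu Q (X u) G); last first.
  have -> : sgrad S nu Q (X u) = (fun=> 0).
    by rewrite /sgrad xgetPN // => G sG; apply: noG; exists G.
  by rewrite !mul0mx.
have sG : is_sgrad S nu Q (X u) (sgrad S nu Q (X u)).
  exact: (@xgetPex _ (fun=> 0) [set G | is_sgrad S nu Q (X u) G]).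
have sgD := is_sgrad_derive pX Uu sG.
have sym (Z : 'cV[R]_2 -> 'cV[R]_3) : classC 2 U Z -> 'D_v ('D_w Z) u = 'D_w ('D_v Z) u.
  move=> [dZ DZ]; have nd : \forall x \near u, differentiable Z x by apply: filterS nU.
  exact: derive_symmetric nd ((DZ w).1 u Uu) ((DZ v).1 u Uu).
have DQX a b : 'D_a ('D_b Y) u =
    sgrad S nu Q (X u) ('d X u a) *m 'd X u b + Q (X u) *m 'D_a ('D_b X) u.
  have [dQ DQ] := sgD a.
  have dDX : derivable ('D_b X) u a by apply: diff_derivable; exact: (CX.2 b).1.
  have [_ E] := is_derive_mulmx dQ dDX.
  have nYX : \forall x \near u, 'D_b Y x = Q (X x) *m 'D_b X x.
    by apply: filterS nU => x; exact: YX.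
  refine (etrans (near_eq_derive _ nYX) (etrans E _)).
  by rewrite DQ (deriveE b (CX.1 u Uu)).
by have := etrans (esym (DQX v w)) (etrans (sym Y CY) (DQX w v)); rewrite (sym X CX) => /addIr.
Qed.

(** In [H e1 *m e2 = H e2 *m e1] the scalar product with [e1] leaves only the [e1] component of
    [a3], and that with [e2] only its [e2] component, each times the nonzero triple product of the
    frame. *)
Lemma axial_component_eq0 (e1 e2 n a1 a2 a3 : 'cV[R]_3) (H : tensor3 R) :
  orthonormal3 e1 e2 n -> 0 < dotv (crossv e1 e2) n -> dotv n a3 = 0 ->
  (forall v, H v = otimes (skewW e1) a1 v + otimes (skewW e2) a2 v + otimes (skewW n) a3 v) ->
  H e1 *m e2 = H e2 *m e1 -> a3 = 0.
Proof.
move=> oe pos na3 HE; rewrite !HE /otimes !mulmxDl -!scalemxAl !mul_skewW => Hsym.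
have self (u : 'cV[R]_3) : crossv u u = 0 by apply: eq_cV3; rewrite crossvE mxE; ring.
rewrite !self !scaler0 add0r addr0 in Hsym.
have d1 := congr1 (dotv e1) Hsym; have d2 := congr1 (dotv e2) Hsym.
rewrite !dotvDr !dotvZr !dotv_crossl !dotv_crossr !mulr0 !add0r in d1 d2.
have t12 : dotv e1 (crossv n e2) = - dotv (crossv e1 e2) n by rewrite !dotvE !crossvE; ring.
have t21 : dotv e2 (crossv n e1) = dotv (crossv e1 e2) n by rewrite !dotvE !crossvE; ring.
apply: (orthonormal3_eq0 oe) => //.
- by move/eqP: d1; rewrite t12 mulrN oppr_eq0 mulf_eq0 (gt_eqF pos) orbF => /eqP.
- by move/esym/eqP: d2; rewrite t21 mulf_eq0 (gt_eqF pos) orbF => /eqP.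
Qed.

End RotationGradient.

(** * Assembly in a chart around the given point *)

Unset Implicit Arguments.
Set Strict Implicit.

Theorem proposition3 (R : realType) (S : set 'cV[R]_3)
    (nu y nustar : 'cV[R]_3 -> 'cV[R]_3) (Q U : 'cV[R]_3 -> 'M[R]_3)
    (e1 e2 a1 a2 a3 : 'cV[R]_3 -> 'cV[R]_3)
    (S_C3 : surface 3 S)
    (nu_normal : unit_normal S nu)
    (y_isometric : isometric_deformation S nu y)
    (y_polar : polar_decomposition S nu y Q U)
    (nustar_orient : forall x, S x -> nustar (y x) = Q x *m nu x)
    (frame : moving_frame S nu e1 e2)
    (a1_tan : tangential S a1) (a2_tan : tangential S a2)
    (a3_tan : tangential S a3)
    (H_repr : forall x, S x -> forall v : 'cV[R]_3,
       invariant_rotation_gradient S nu Q x v =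
         otimes (skewW (e1 x)) (a1 x) v + otimes (skewW (e2 x)) (a2 x) v
         + otimes (skewW (nu x)) (a3 x) v) :
  forall x, S x ->
    a3 x = 0 /\
    gaussian_curvature (y @` S) nustar (y x) = gaussian_curvature S nu x.
Proof.
move=> x Sx.
have [[y_C2 y_inj Sstar_C2 _] y_angles y_areas] := y_isometric.
have [U0 [X [chX [u0 Uu0 Xu0]]]] := S_C3 x Sx; subst x.
have pX := chart_parametrization chX; have [oU _ _ immX homX] := pX.
have SX u : U0 u -> S (X u) by move=> Uu; exact: (homX u Uu).1.
have [_ C3X _ _ _] := chX; have C2X : classC 2 U0 X by exact: classC_le C3X.
have chX2 : chart 2 S U0 X by have [h1 _ h3 h4 h5] := chX; split.
have C2Y : classC 2 U0 (y \o X) := y_C2 _ _ chX2.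
have dX u : U0 u -> differentiable X u by exact: C3X.1.
have dY u : U0 u -> differentiable (y \o X) u by exact: C2Y.1.
have nn u : U0 u -> dotv (nu (X u)) (nu (X u)) = 1.
  by move=> Uu; apply/enorm1; exact: (nu_normal.2 _ (SX u Uu)).1.
have nX u v : U0 u -> dotv (nu (X u)) ('d X u v) = 0.
  by move=> Uu; apply: (nu_normal.2 _ (SX u Uu)).2; rewrite (tangentE pX Uu); exists v.
have tanE u w : U0 u -> tangent S (X u) w <-> dotv (nu (X u)) w = 0.
  by move=> Uu; exact: tangent_normalE pX Uu (nn u Uu) (fun v => nX u v Uu).
have oe u : U0 u -> orthonormal3 (e1 (X u)) (e2 (X u)) (nu (X u)).
  by move=> Uu; exact: moving_frame_orthonormal nu_normal frame (SX u Uu).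
have QQ u : U0 u -> (Q (X u))^T *m Q (X u) = 1%:M.
  by move=> Uu; have [_ [h _] _ _ _] := y_polar _ (SX u Uu).
(* Preservation of angles and areas gives [dY = Q dX], after tangency has been rewritten as
   orthogonality to the normal. *)
have dYE u v : U0 u -> 'd (y \o X) u v = Q (X u) *m 'd X u v.
  move=> Uu; have [FE _ UT Un Upos] := y_polar _ (SX u Uu).
  have nXu w := nX u w Uu.
  have [lin_sg _ _] := is_sgradP pX Uu nXu (dY u Uu).
  have sgY := sgrad_param pX Uu nXu (dY u Uu) v.
  have FdX := etrans (sgrad_mxE lin_sg ('d X u v)) (etrans sgY (deriveE v (dY u Uu))).
  refine (etrans (esym FdX) _).
  apply: (isometric_stretch (oe u Uu) FE (QQ u Uu) UT Un).
  - by move=> w nw; apply: Upos; apply/(tanE u w Uu).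
  - by move=> a b na nb; apply: y_angles; [exact: SX|exact/(tanE u a Uu)|exact/(tanE u b Uu)].
  - by move=> a b na nb; apply: y_areas; [exact: SX|exact/(tanE u a Uu)|exact/(tanE u b Uu)].
  - exact: nXu.
have DYE v u : U0 u -> 'D_v (y \o X) u = Q (X u) *m 'D_v X u.
  by move=> Uu; rewrite (deriveE v (dX u Uu)); exact: etrans (deriveE v (dY u Uu)) (dYE u v Uu).
have dotQ u a b : U0 u -> dotv (Q (X u) *m a) (Q (X u) *m b) = dotv a b.
  by move=> Uu; rewrite dotv_trmx mulmxA QQ // mul1mx.
have metric u v w : U0 u ->
    dotv ('D_v (y \o X) u) ('D_w (y \o X) u) = dotv ('D_v X u) ('D_w X u).
  by move=> Uu; rewrite (DYE v u Uu) (DYE w u Uu) dotQ.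
have pY : parametrization (y @` S) U0 (y \o X).
  apply: parametrization_image pX Sstar_C2 y_inj _ _; first exact: classC_le C2Y.
  move=> u Uu v; rewrite (dYE u v Uu) => Qv0; apply: (immX u Uu).
  by rewrite -[LHS]mul1mx -(QQ u Uu) -mulmxA Qv0 mulmx0.
have n0 : nu (X u0) != 0.
  by apply: contra_eq_neq (nn u0 Uu0) => ->; rewrite dotv0l eq_sym oner_eq0.
have oe0 := oe u0 Uu0; have [e11 e22 _ e12 [ne1 ne2]] := oe0.
have nX0 v := nX u0 v Uu0.
(* Parameter directions whose images at the base point are the frame vectors [e1] and [e2]. *)
have [v1 dXv1] := parametrization_normal pX Uu0 n0 nX0 ne1.
have [v2 dXv2] := parametrization_normal pX Uu0 n0 nX0 ne2.
split.
  have [_ _ _ _ pos] := frame _ (SX u0 Uu0).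
  apply: (axial_component_eq0 oe0 pos _ (H_repr _ (SX u0 Uu0))).
    by apply/(tanE u0 _ Uu0); exact: a3_tan.
  rewrite /invariant_rotation_gradient -!mulmxA; congr (_ *m _).
  have := rotation_gradient_symmetric nu v1 v2 pX Uu0 C2X C2Y DYE.
  by rewrite dXv1 dXv2.
have oX : orthonormal3 ('d X u0 v1) ('d X u0 v2) (nu (X u0)) by rewrite dXv1 dXv2.
have nsY u : U0 u -> nustar ((y \o X) u) = Q (X u) *m nu (X u).
  by move=> Uu; exact: nustar_orient (SX u Uu).
have orth_eq (a b c a' b' c' : 'cV[R]_3) : a = a' -> b = b' -> c = c' ->
    orthonormal3 a b c -> orthonormal3 a' b' c' by move=> -> -> ->.
have oY : orthonormal3 ('d (y \o X) u0 v1) ('d (y \o X) u0 v2) (nustar ((y \o X) u0)).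
  exact: orth_eq (esym (dYE u0 v1 Uu0)) (esym (dYE u0 v2 Uu0)) (esym (nsY u0 Uu0))
    (orthonormal3_mul (QQ u0 Uu0) oX).
have oDX : orthonormal3 ('D_v1 X u0) ('D_v2 X u0) (nu (X u0)).
  exact: orth_eq (esym (deriveE v1 (dX u0 Uu0))) (esym (deriveE v2 (dX u0 Uu0))) erefl oX.
have oDY : orthonormal3 ('D_v1 (y \o X) u0) ('D_v2 (y \o X) u0) (nustar ((y \o X) u0)).
  exact: orth_eq (esym (deriveE v1 (dY u0 Uu0))) (esym (deriveE v2 (dY u0 Uu0))) erefl oY.
have nU : \forall u \near u0, U0 u by exact: open_nbhs_nbhs.
have DX v : differentiable ('D_v X) u0 by exact: (C2X.2 v).1.
have DY v : differentiable ('D_v (y \o X)) u0 by exact: (C2Y.2 v).1.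
have cross_neq0 (a b n : 'cV[R]_3) : orthonormal3 a b n -> crossv a b != 0.
  move=> [aa bb _ ab _]; apply: contra_eq_neq (lagrange a b) => ->.
  by rewrite dotv0l aa bb ab expr0n /= subr0 mulr1 eq_sym oner_eq0.
have crX := cross_neq0 _ _ _ oDX; have crY := cross_neq0 _ _ _ oDY.
have nDX u v : U0 u -> dotv (nu (X u)) ('D_v X u) = 0.
  by move=> Uu; rewrite (deriveE v (dX u Uu)) nX.
have dr : differentiable
    (fun u => dotv ((nu \o X) u) (crossv ('D_v1 X u) ('D_v2 X u))) u0.
  apply: (unit_normal_triple_differentiable _ (DX v1) (DX v2) crX).
    exact: within_comp_continuous pX Uu0 nu_normal.1.
  by apply: filterS nU => u Uu; split; [exact: nn|exact: nDX|exact: nDX].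
have dnX : differentiable (nu \o X) u0.
  apply: normal_differentiable (DX v1) (DX v2) crX _ dr.
  by apply: filterS nU => u Uu; split; exact: nDX.
have nDY u v : U0 u -> dotv (nustar ((y \o X) u)) ('D_v (y \o X) u) = 0.
  by move=> Uu; rewrite (nsY u Uu) (DYE v u Uu) (dotQ u _ _ Uu) nDX.
have dnY : differentiable (nustar \o (y \o X)) u0.
  apply: normal_differentiable (DY v1) (DY v2) crY _ _.
    by apply: filterS nU => u Uu; split; exact: nDY.
  (* Because [Q] has determinant 1, the triple product of the image normal equals that of [nu], and
     its differentiability carries over. *)
  apply: (near_eq_differentiable _ dr).1; apply: filterS nU => u Uu.
  have [_ [_ detQ] _ _ _] := y_polar _ (SX u Uu).
  have -> : (nustar \o (y \o X)) u = Q (X u) *m nu (X u) by exact: nsY.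
  by rewrite (DYE v1 u Uu) (DYE v2 u Uu) dotv_crossv_det detQ mul1r.
have KX := gaussian_curvature_second_form pX Uu0 C2X nn nX dnX oX.
have nnY u : U0 u -> dotv (nustar ((y \o X) u)) (nustar ((y \o X) u)) = 1.
  by move=> Uu; rewrite (nsY u Uu) (dotQ u _ _ Uu) nn.
have nY u v : U0 u -> dotv (nustar ((y \o X) u)) ('d (y \o X) u v) = 0.
  by move=> Uu; rewrite (nsY u Uu) (dYE u v Uu) (dotQ u _ _ Uu) nX.
have KY := gaussian_curvature_second_form pY Uu0 C2Y nnY nY dnY oY.
have KK := theorema_egregium oU Uu0 C3X C2Y metric oDX oDY.
exact: etrans KY (etrans KK (esym KX)).
Qed.
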